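(* For all integers $a,b\ge1$ and every $a$-tuple $\underline{\lambda}=(\lambda^{(1)},\dots,\lambda^{(a)})$ of partitions with $\sum_{r=1}^a|\lambda^{(r)}|=b$, $$\mathrm{Ch}\,\big(S^{\underline{\lambda}}\uparrow_{C_a\wr S_b}^{S_{ab}}\big)=\prod_{r=1}^{a}s_{\lambda^{(r)}}\big[\mathrm{NFD}_{a,r}^{\mathrm{cont}}(\mathbf{x})\big].$$
   Context: Representations are over $\mathbb{C}$; $\uparrow$ denotes induction. $\mathrm{Ch}$ is the Frobenius characteristic: $\mathrm{Ch}\,S^\lambda=s_\lambda(\mathbf{x})$ for the Specht module $S^\lambda$, extended additively, $\mathbf{x}=(x_1,x_2,\dots)$. Wreath products: $G\wr S_n$ is the set $G^n\times S_n$ with product $(g_1,\dots,g_n,\sigma)(h_1,\dots,h_n,\tau)=(g_1h_{\sigma^{-1}(1)},\dots,g_nh_{\sigma^{-1}(n)},\sigma\tau)$. For a sequence $\alpha$ of nonnegative integers summing to $n$, $G\wr\prod_iS_{\alpha_i}:=\prod_i(G\wr S_{\alpha_i})$, naturally a subgroup of $G\wr S_n$. If $U$ is a $G$-module and $V$ an $S_n$-module, $U\wr V:=U^{\otimes n}\otimes V$ with $G\wr S_n$ acting by $(g_1,\dots,g_n,\sigma)\cdot(u_1\otimes\cdots\otimes u_n\otimes v)=(g_1u_{\sigma^{-1}(1)})\otimes\cdots\otimes(g_nu_{\sigma^{-1}(n)})\otimes(\sigma v)$. $C_a=\langle\sigma_a\rangle\le S_a$, $\sigma_a=(1\,2\,\cdots\,a)$,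 and $\chi_a^r(\sigma_a)=\omega_a^r$ for a fixed primitive $a$th root of unity $\omega_a$. $C_a\wr S_b$ is embedded in $S_{ab}$ by permuting the $b$ consecutive size-$a$ intervals of $\{1,\dots,ab\}$ among themselves and cyclically rotating each interval independently. The irreducible representations of $C_a\wr S_b$ are $$S^{\underline{\lambda}}:=\big((\chi_a^1\wr S^{\lambda^{(1)}})\otimes\cdots\otimes(\chi_a^a\wr S^{\lambda^{(a)}})\big)\uparrow_{C_a\wr S_{\alpha(\underline{\lambda})}}^{C_a\wr S_b},$$ where $\alpha(\underline{\lambda})=(|\lambda^{(1)}|,\dots,|\lambda^{(a)}|)$ and $S_{\alpha(\underline{\lambda})}=\prod_{r}S_{|\lambda^{(r)}|}$. Necklaces: $W_a$ is the set of words of length $a$ with letters in $\mathbb{Z}_{\ge1}$; a necklace is an orbit of $W_a$ under cyclic rotation. Writing $w=v^f$ with $v$ primitive, $\mathrm{freq}(w)=f$. $\mathrm{cont}(w)=(\alpha_1,\alpha_2,\dots)$, $\alpha_j$ the number of $j$'s in $w$. Both are well defined on necklaces. $\mathrm{NFD}_{a,r}$ is the set of necklaces of length $a$ words with frequency dividing $r$, and $\mathrm{NFD}_{a,r}^{\mathrm{cont}}(\mathbf{x})=\sum_{N\in\mathrm{NFD}_{a,r}}\mathbf{x}^{\mathrm{cont}(N)}$. Plethysm: if $f$ is a symmetric function and $g=m_1+m_2+\cdots$ is a sum of monomials (with repetition), $f[g]=f(m_1,m_2,\dots)$. *)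

(* Defs.v *)
From HB Require Import structures.
From mathcomp Require Import all_boot all_order all_algebra.
From mathcomp Require Import all_fingroup algC.
From mathcomp Require Import mxrepresentation classfun character.
From mathcomp Require Import mpoly.

Set Implicit Arguments.
Unset Strict Implicit.
Unset Printing Implicit Defensive.

Import GroupScope GRing.Theory.
Local Open Scope ring_scope.

(* MathComp composes permutations from left to right and lets representations *)
(* act on row vectors on the right.  All groups and modules below follow this *)
(* convention: each group is the opposite of the corresponding group of       *)
(* permutations composed from right to left, and a right module over it is    *)
(* the same thing as a left module over the latter.                           *)
(* Complex representations are taken over algC, where every complex           *)
(* representation of a finite group can be realised.                          *)

Definition is_partition (lam : seq nat) : bool :=
  sorted geq lam && (0%N \notin lam).

(* The cells of the diagram of lam are numbered 0, ..., sumn lam - 1 in       *)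
(* reading order (row by row); these are the row and the column of cell i.    *)
Definition cell_row (lam : seq nat) (i : nat) : nat := reshape_index lam i.
Definition cell_col (lam : seq nat) (i : nat) : nat := reshape_offset lam i.

(* A symmetric function F(x_1, x_2, ...) is given by all its restrictions     *)
(* F N = F(x_1, ..., x_N, 0, 0, ...); two of them are equal iff all these     *)
(* restrictions are (the ring of symmetric functions is the graded inverse    *)
(* limit of the rings of symmetric polynomials).                              *)
Definition symfun := forall N : nat, {mpoly algC[N]}.

Definition is_ssyt (lam : seq nat) (N : nat)
    (T : {ffun 'I_(sumn lam) -> 'I_N}) : bool :=
  [forall i : 'I_(sumn lam), forall j : 'I_(sumn lam),
     ((cell_row lam i == cell_row lam j) && (cell_col lam i <= cell_col lam j)
        ==> (T i <= T j))%N
  && ((cell_col lam i == cell_col lam j) && (cell_row lam i < cell_row lam j)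
        ==> (T i < T j))%N].

Definition schur (lam : seq nat) : symfun := fun N =>
  \sum_(T : {ffun 'I_(sumn lam) -> 'I_N} | is_ssyt T)
     \prod_(i < sumn lam) 'X_(T i).

(* f[m_1 + ... + m_K] = f(m_1, ..., m_K, 0, 0, ...), for monomials m_i.       *)
Definition plethysm (f : symfun) (N : nat) (g : seq 'X_{1..N}) :
    {mpoly algC[N]} :=
  f (size g) \mPo [tuple 'X_[tnth (in_tuple g) i] | i < size g].

Definition word_pow (T : Type) (k : nat) (v : seq T) : seq T :=
  flatten (nseq k v).

(* If v = u ^ k with k > 0, then u is the prefix of v of length size v / k.   *)
Definition primitive_word (T : eqType) (v : seq T) : bool :=
  (v != [::]) &&
  [forall k : 'I_(size v).+1,
     (v == word_pow k (take (size v %/ k) v)) ==> (k == 1%N :> nat)].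

Lemma word_powP (T : eqType) (v u : seq T) k :
  v = word_pow k u -> v != [::] ->
  (k <= size v)%N /\ u = take (size v %/ k) v.
Proof.
case: k => [|k] -> //= nz; rewrite size_cat.
have sz : size (flatten (nseq k u)) = (k * size u)%N.
  by elim: k {nz} => //= k IH; rewrite size_cat IH mulSn.
rewrite sz -mulSn mulKn // take_size_cat //; split=> //.
rewrite leq_pmulr //; case: u nz {sz} => //=.
by elim: k.
Qed.

Lemma primitive_wordP (T : eqType) (v : seq T) :
  reflect (v <> [::] /\ forall k u, v = word_pow k u -> k = 1%N)
          (primitive_word v).
Proof.
apply: (iffP andP) => [[nz /forallP pv]|[/eqP nz pv]].
  split=> [|k u def_v]; first exact/eqP.
  have [le_k def_u] := word_powP def_v nz.
  have := pv (Ordinal (n := (size v).+1) le_k).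
  by rewrite /= -def_u -def_v eqxx => /eqP.
by split=> //; apply/forallP=> k; apply/implyP=> /eqP/pv/eqP.
Qed.

(* The f such that w = v ^ f with v primitive (and then f <= size w).         *)
Definition freq (T : eqType) (w : seq T) : nat :=
  find (fun f => let v := take (size w %/ f) w in
                 primitive_word v && (w == word_pow f v))
       (iota 0 (size w).+1).

(* Words and necklaces in N variables only use the N letters of 'I_N.         *)
Definition necklace_of (a N : nat) (w : a.-tuple 'I_N) : {set a.-tuple 'I_N} :=
  [set [tuple of rot i w] | i : 'I_a].

Definition NFD (a r N : nat) : {set {set a.-tuple 'I_N}} :=
  [set necklace_of w | w : a.-tuple 'I_N & (freq w %| r)%N].

Definition cont (N : nat) (w : seq 'I_N) : 'X_{1..N} :=
  [multinom count_mem j w | j < N].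

(* The content of a necklace is that of any of its words.                     *)
Definition necklace_cont (a N : nat) (C : {set a.-tuple 'I_N}) : 'X_{1..N} :=
  if [pick w in C] is Some w then cont w else 0%MM.

(* The monomials, with repetition, of which NFD_{a,r}^cont(x) is the sum.     *)
Definition NFD_cont (a r N : nat) : seq 'X_{1..N} :=
  [seq necklace_cont C | C <- enum (NFD a r N)].

Section Specht.

Variables (n : nat) (lam : seq nat).

Definition row_stab : {set 'S_n} :=
  [set s : 'S_n | [forall i, cell_row lam (s i) == cell_row lam i]].
Definition col_stab : {set 'S_n} :=
  [set s : 'S_n | [forall i, cell_col lam (s i) == cell_col lam i]].

(* The Young symmetrizer of the tableau of shape lam (a partition of n) whose *)
(* i-th cell has entry i, as an element of the group algebra.  With           *)
(* permutations composed from right to left it reads b * a, where a (resp. b) *)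
(* is the (resp. signed) sum of the row (resp. column) stabiliser; the Specht *)
(* module is the ideal it generates (the span of the polytabloids).           *)
Definition young_symmetrizer : 'rV[algC]_#|[set: 'S_n]| :=
  \sum_(p in row_stab) \sum_(q in col_stab)
     (-1) ^+ odd_perm q *: delta_mx 0 (gring_index [set: 'S_n] (p * q)%g).

Definition Specht :=
  submod_repr (cyclic_mx_module (regular_repr algC [set: 'S_n])
                                young_symmetrizer).

Definition Specht_char : 'CF([set: 'S_n]) := cfRepr Specht.

End Specht.

(* The lists of at most n integers in {0, ..., n} include all partitions of   *)
(* n.  '[phi, Specht_char n lam] is the multiplicity of the Specht module.    *)
Definition Ch (n : nat) (phi : 'CF([set: 'S_n])) : symfun := fun N =>
  \sum_(l : n.-bseq 'I_n.+1 |
          is_partition (map val l) && (sumn (map val l) == n))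
     '[phi, Specht_char n (map val l)] *: schur (map val l) N.

Record wreath (gT : finGroupType) (n : nat) :=
  Wreath { wbase : {ffun 'I_n -> gT}; wperm : 'S_n }.

Section WreathGroup.

Variables (gT : finGroupType) (n : nat).
Implicit Types x y z : wreath gT n.

Fact wreath_pairK :
  cancel (fun x => (wbase x, wperm x)) (fun p => Wreath p.1 p.2).
Proof. by case. Qed.
HB.instance Definition _ := Finite.copy (wreath gT n) (can_type wreath_pairK).

Local Open Scope group_scope.

(* This is y . x for the usual product                                        *)
(*   (g_i, s) . (h_i, t) = (g_i h_(s^-1 i), s t).                             *)
Definition wreath_mul x y : wreath gT n :=
  Wreath [ffun i => wbase x ((wperm y)^-1 i) * wbase y i] (wperm x * wperm y).
Definition wreath_one : wreath gT n := Wreath [ffun=> 1] 1.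
Definition wreath_inv x : wreath gT n :=
  Wreath [ffun i => (wbase x (wperm x i))^-1] (wperm x)^-1.

Fact wreath_mulA : associative wreath_mul.
Proof.
move=> x y z; congr Wreath; last by rewrite mulgA.
by apply/ffunP=> i; rewrite !ffunE /= invMg permM mulgA.
Qed.

Fact wreath_mul1 : left_id wreath_one wreath_mul.
Proof.
case=> g s; congr Wreath; last by rewrite mul1g.
by apply/ffunP=> i; rewrite !ffunE mul1g.
Qed.

Fact wreath_mulV : left_inverse wreath_one wreath_inv wreath_mul.
Proof.
case=> g s; congr Wreath; last by rewrite mulVg.
by apply/ffunP=> i; rewrite !ffunE /= permKV mulVg.
Qed.

HB.instance Definition _ :=
  Finite_isGroup.Build (wreath gT n) wreath_mulA wreath_mul1 wreath_mulV.

Lemma wreathM1 x y i : wbase (x * y) i = wbase x ((wperm y)^-1 i) * wbase y i.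
Proof. by rewrite ffunE. Qed.
Lemma wreathM2 x y : wperm (x * y) = wperm x * wperm y.
Proof. by []. Qed.
Lemma wreath11 i : wbase (1 : wreath gT n) i = 1.
Proof. by rewrite ffunE. Qed.
Lemma wreath12 : wperm (1 : wreath gT n) = 1.
Proof. by []. Qed.

End WreathGroup.

Section Wreath.

Variables (gT : finGroupType) (G : {group gT}) (n : nat).

Definition wr : {set wreath gT n} := [set x | [forall i, wbase x i \in G]].

Fact wr_group_set : group_set wr.
Proof.
apply/group_setP; split=> [|x y]; rewrite !inE.
  by apply/forallP=> i; rewrite wreath11 group1.
by move=> /forallP Gx /forallP Gy; apply/forallP=> i; rewrite wreathM1 groupM.
Qed.
Canonical wr_group := Group wr_group_set.

Lemma wrP x : reflect (forall i, wbase x i \in G) (x \in wr).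
Proof. by rewrite inE; apply: forallP. Qed.

Variables (d m : nat).
Variables (rU : mx_representation algC G d).
Variables (rV : mx_representation algC [set: 'S_n] m).

(* The basis vectors of the n-th tensor power of U are indexed by the maps    *)
(* f : 'I_n -> 'I_d, with f standing for e_(f 0) (x) ... (x) e_(f (n - 1)).   *)
Definition tensor_index (p : 'I_#|{ffun 'I_n -> 'I_d}|) : {ffun 'I_n -> 'I_d} :=
  enum_val p.

(* (u_0 (x) ... (x) u_(n-1)) . (g, s) is the tensor of the u_(s^-1 i) . g_i.  *)
Definition tensor_power_mx (x : wreath gT n) : 'M[algC]_#|{ffun 'I_n -> 'I_d}| :=
  \matrix_(p, q) \prod_(i < n) rU (wbase x i) (tensor_index p ((wperm x)^-1 i)%g)
                                          (tensor_index q i).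

Fact tensor_index_inj : injective tensor_index.
Proof. exact: enum_val_inj. Qed.

Fact tensor_indexK h : tensor_index (enum_rank h) = h.
Proof. exact: enum_rankK. Qed.

Fact tensor_power_mx_repr : mx_repr wr tensor_power_mx.
Proof.
split=> [|x y /wrP Gx /wrP Gy]; apply/matrixP=> p q; rewrite !mxE.
  transitivity (\prod_(i < n) ((tensor_index p i == tensor_index q i)%:R : algC)).
    by apply: eq_bigr => i _; rewrite wreath11 repr_mx1 wreath12 invg1 perm1 mxE.
  rewrite -natr_prod; congr _%:R.
  case: (p =P q) => [->|/eqP neq_pq]; first by rewrite big1 // => i; rewrite eqxx.
  apply/eqP; apply: contraR neq_pq => nz.
  rewrite -(inj_eq tensor_index_inj); apply/eqP/ffunP=> i; apply/eqP.
  by apply: contraR nz => /negbTE ne_i; rewrite (bigD1 i) //= ne_i mul0n.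
pose F (h : 'I_n -> 'I_d) := \prod_(i < n) (rU (wbase x ((wperm y)^-1 i)%g)
                             (tensor_index p ((wperm x)^-1 ((wperm y)^-1 i))%g) (h i)
                        * rU (wbase y i) (h i) (tensor_index q i)).
transitivity (\sum_(h : {ffun 'I_n -> 'I_d}) F h).
  rewrite /F -(bigA_distr_bigA (fun i k =>
     rU (wbase x ((wperm y)^-1 i)%g) (tensor_index p ((wperm x)^-1 ((wperm y)^-1 i))%g) k
       * rU (wbase y i) k (tensor_index q i))) /=.
  apply: eq_bigr => i _; rewrite wreathM1 repr_mxM // mxE.
  by rewrite ?wreathM2 invMg permM.
rewrite (reindex_onto (fun k => [ffun i => tensor_index k ((wperm y)^-1 i)%g])
    (fun h : {ffun _} => enum_rank [ffun i => h (wperm y i)])) /=; last first.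
  by move=> h _; apply/ffunP=> i; rewrite ffunE tensor_indexK ffunE permKV.
rewrite (eq_bigl xpredT) => [|k]; last first.
  rewrite -(inj_eq tensor_index_inj) tensor_indexK; apply/eqP/ffunP=> i.
  by rewrite !ffunE permK.
apply: eq_bigr => k _; rewrite /F big_split /= !mxE.
congr (_ * _); last by apply: eq_bigr => i _; rewrite ffunE.
rewrite [RHS](reindex_inj (@perm_inj _ ((wperm y)^-1)%g)) /=.
by apply: eq_bigr => i _; rewrite ffunE.
Qed.
Definition tensor_power_repr := MxRepresentation tensor_power_mx_repr.

Fact wreath_snd_repr : mx_repr wr (fun x => rV (wperm x)).
Proof.
split=> [|x y _ _]; first by rewrite wreath12 repr_mx1.
by rewrite wreathM2 repr_mxM ?inE.
Qed.

(* U wr V, that is, the tensor product of U^{(x) n} and V.                    *)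
Definition wreath_repr :=
  prod_repr tensor_power_repr (MxRepresentation wreath_snd_repr).

End Wreath.

Section WreathYoung.

Variables (gT : finGroupType) (G : {group gT}).
Variables (k n : nat) (alpha : 'I_k -> nat).
Hypothesis sum_alpha : (\sum_(r < k) alpha r)%N = n.

(* {0, ..., n - 1} is cut into k consecutive intervals of lengths alpha_r:    *)
(* block_elt r j is the j-th element of the r-th one, and block i is the      *)
(* index of the interval containing i.                                        *)
Definition block_elt (r : 'I_k) (j : 'I_(alpha r)) : 'I_n :=
  cast_ord sum_alpha (tagnat.Rank r j).
Definition block (i : 'I_n) : 'I_k :=
  tagnat.sig1 (cast_ord (esym sum_alpha) i).

Lemma block_eltK r j : block (@block_elt r j) = r.
Proof. by rewrite /block /block_elt cast_ordK tagnat.Rank1K. Qed.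

Lemma block_elt_inj r : injective (@block_elt r).
Proof.
move=> i j /cast_ord_inj /tagnat.rank_inj /eqP.
by rewrite -tag_eqE /tag_eq /= eqxx tagged_asE => /eqP.
Qed.

Lemma block_eltP r i : block i = r -> exists j, i = @block_elt r j.
Proof.
move=> <-; exists (tagnat.sig2 (cast_ord (esym sum_alpha) i)).
by rewrite /block_elt tagnat.sig2K cast_ordKV.
Qed.

Definition wrY : {set wreath gT n} :=
  [set x in wr G n | [forall i, block (wperm x i) == block i]].

Lemma wrYP x :
  reflect (x \in wr G n /\ forall i, block (wperm x i) = block i) (x \in wrY).
Proof.
rewrite [x \in wrY]in_set; apply: (iffP andP) => -[Gx bx]; split=> //.
  by move=> i; apply/eqP/(forallP bx).
by apply/forallP=> i; rewrite bx.
Qed.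

Fact wrY_group_set : group_set wrY.
Proof.
apply/group_setP; split=> [|x y /wrYP[Gx bx] /wrYP[Gy by_]]; apply/wrYP; split.
- exact: (group1 (wr_group G n)).
- by move=> i; rewrite wreath12 perm1.
- exact: (groupM (G := wr_group G n)).
- by move=> i; rewrite wreathM2 permM by_.
Qed.
Canonical wrY_group := Group wrY_group_set.

Definition perm_block (r : 'I_k) (s : 'S_n) : 'S_(alpha r) :=
  odflt 1%g [pick t : 'S_(alpha r) |
               [forall j, block_elt (t j) == s (block_elt j)]].
Definition wreath_proj (r : 'I_k) (x : wreath gT n) : wreath gT (alpha r) :=
  Wreath [ffun j => wbase x (block_elt j)] (perm_block r (wperm x)).

Lemma perm_blockP r (s : 'S_n) : (forall i, block (s i) = block i) ->
  forall j, block_elt (perm_block r s j) = s (block_elt j).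
Proof.
move=> bs; rewrite /perm_block; case: pickP => [t /forallP t_s j|no_t] /=.
  exact/eqP.
have ex (j : 'I_(alpha r)) : exists j' : 'I_(alpha r), s (block_elt j) == block_elt j'.
  have [|j' ->] := @block_eltP r (s (block_elt j)); last by exists j'.
  by rewrite bs block_eltK.
pose t j := xchoose (ex j).
have tE j : block_elt (t j) = s (block_elt j) by apply/esym/eqP/(xchooseP (ex j)).
have t_inj : injective t.
  by move=> i j tij; apply/block_elt_inj/(@perm_inj _ s); rewrite -!tE tij.
by have/forallP[] := no_t (perm t_inj); move=> j; rewrite permE tE.
Qed.

Fact wreath_projM r : {in wrY &, {morph wreath_proj r : x y / (x * y)%g}}.
Proof.
move=> x y /wrYP[_ bx] /wrYP[_ by_].
have sM : perm_block r (wperm (x * y)%g)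
          = (perm_block r (wperm x) * perm_block r (wperm y))%g.
  apply/permP=> j; apply: (@block_elt_inj r); rewrite permM !perm_blockP //.
    by rewrite wreathM2 permM.
  by move=> i; rewrite wreathM2 permM by_.
congr Wreath; last exact: sM.
apply/ffunP=> j; rewrite !ffunE /=; congr (wbase x _ * _)%g.
apply: (@perm_inj _ (wperm y)); rewrite permKV -perm_blockP //.
by rewrite permKV.
Qed.
Canonical wreath_proj_morphism r := Morphism (@wreath_projM r).

Lemma wrY_sub_proj r : wrY \subset wreath_proj r @*^-1 (wr G (alpha r)).
Proof.
apply/subsetP=> x Yx; apply/morphpreP; split=> //.
by case/wrYP: Yx => /wrP Gx _; apply/wrP=> j; rewrite ffunE.
Qed.

Lemma wrY_wr : wrY \subset wr G n.
Proof. by apply/subsetP=> x /wrYP[]. Qed.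

(* A module over the r-th factor, seen as a module over the product.          *)
Definition factor_repr r m
    (rW : mx_representation algC (wr_group G (alpha r)) m) :=
  subg_repr (morphpre_repr (wreath_proj_morphism r) rW) (wrY_sub_proj r).

End WreathYoung.

Definition rotation (a : nat) : 'S_a := perm (@ordS_inj a).
Definition Cyc (a : nat) : {group 'S_a} := <[rotation a]>%G.

Lemma rotationX a k (i : 'I_a) : (rotation a ^+ k)%g i = ((i + k) %% a)%N :> nat.
Proof.
elim: k => [|k IHk]; first by rewrite expg0 perm1 addn0 modn_small.
by rewrite expgSr permM permE /= IHk -addn1 modnDml addn1 addnS.
Qed.

Definition rotation_log (a : nat) (g : 'S_a) : nat :=
  if [pick k : 'I_a | g == (rotation a ^+ k)%g] is Some k then val k else 0%N.

Lemma rotation_logX a (i0 : 'I_a) k :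
  rotation_log (rotation a ^+ k)%g = (k %% a)%N.
Proof.
rewrite /rotation_log; case: pickP => [j /eqP eq_j|no_j].
  have := congr1 (fun s : 'S_a => nat_of_ord (s i0)) eq_j.
  rewrite /= !rotationX => /eqP; rewrite eqn_modDl => /eqP ->.
  by rewrite modn_small.
have lt_k : (k %% a < a)%N by rewrite ltn_mod; apply: leq_ltn_trans (ltn_ord i0).
have /eqP[] := no_j (Ordinal lt_k).
by apply/permP=> i; apply: val_inj; rewrite /= !rotationX modnDmr.
Qed.

Section Chi.

Variables (a : nat) (omega : algC).
Hypothesis prim_omega : a.-primitive_root omega.

(* chi_a^r, the character mapping sigma_a to omega^r.                         *)
Fact chi_mx_repr (r : nat) :
  mx_repr (Cyc a) (fun g => (omega ^+ (r * rotation_log g))%:M : 'M[algC]_1).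
Proof.
have i0 : 'I_a := Ordinal (prim_order_gt0 prim_omega).
split=> [|_ _ /cycleP[i ->] /cycleP[j ->]].
  by rewrite -(expg0 (rotation a)) rotation_logX // mod0n muln0.
rewrite -expgD !rotation_logX // -scalar_mxM -exprD -mulnDr; congr (_%:M).
apply/eqP; rewrite (eq_prim_root_expr prim_omega).
by rewrite modnMmr -[X in _ == X]modnMmr modnDm modnMmr.
Qed.
Definition chi_repr (r : nat) := MxRepresentation (chi_mx_repr r).

(* S^lam for an a-tuple lam of partitions of total size b, numbered from 0:   *)
(* lam r goes with chi_a^(r + 1).                                             *)
Definition Specht_wreath (b : nat) (lam : 'I_a -> seq nat)
    (sum_lam : (\sum_(r < a) sumn (lam r))%N = b) : 'CF(wr (Cyc a) b) :=
  'Ind[wr (Cyc a) b, wrY (Cyc a) sum_lam]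
    (\prod_(r < a) cfRepr (factor_repr sum_lam
       (wreath_repr (chi_repr r.+1) (Specht (sumn (lam r)) (lam r))))).

End Chi.

Section Embedding.

Variables (a b : nat).

(* The j-th element of the i-th interval is i * a + j.                        *)
Fact interval_elt_subproof (i : 'I_b) (j : 'I_a) : (i * a + j < a * b)%N.
Proof.
apply: (@leq_trans (i.+1 * a)); first by rewrite mulSnr ltn_add2l.
by rewrite mulnC leq_mul2l ltn_ord orbT.
Qed.
Definition interval_elt (i : 'I_b) (j : 'I_a) : 'I_(a * b) :=
  Ordinal (interval_elt_subproof i j).

Fact interval_subproof (k : 'I_(a * b)) : (k %/ a < b)%N.
Proof.
have := leq_ltn_trans (leq0n k) (ltn_ord k); rewrite muln_gt0 => /andP[a0 _].
by rewrite ltn_divLR // [(b * a)%N]mulnC.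
Qed.
Definition interval (k : 'I_(a * b)) : 'I_b := Ordinal (interval_subproof k).

Fact offset_subproof (k : 'I_(a * b)) : (k %% a < a)%N.
Proof.
rewrite ltn_mod.
by have := leq_ltn_trans (leq0n k) (ltn_ord k); rewrite muln_gt0 => /andP[].
Qed.
Definition offset (k : 'I_(a * b)) : 'I_a := Ordinal (offset_subproof k).

Lemma interval_eltK1 i j : interval (interval_elt i j) = i.
Proof.
apply: val_inj; rewrite /= divnMDl ?divn_small ?addn0 //.
exact: leq_ltn_trans (ltn_ord j).
Qed.

Lemma interval_eltK2 i j : offset (interval_elt i j) = j.
Proof. by apply: val_inj; rewrite /= modnMDl modn_small. Qed.

Lemma interval_eltE k : interval_elt (interval k) (offset k) = k.
Proof. by apply: val_inj; rewrite /= -divn_eq. Qed.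

(* (g, s) sends the j-th element of the i-th interval to the g_(s i)(j)-th    *)
(* element of the (s i)-th interval.                                          *)
Definition wreath_act (x : wreath 'S_a b) (k : 'I_(a * b)) : 'I_(a * b) :=
  let i := wperm x (interval k) in interval_elt i (wbase x i (offset k)).

Fact wreath_act_inj x : injective (wreath_act x).
Proof.
move=> k l eq_kl; have := congr1 interval eq_kl; rewrite !interval_eltK1 => /perm_inj eq_i.
have := congr1 offset eq_kl; rewrite !interval_eltK2 eq_i => /perm_inj eq_j.
by rewrite -(interval_eltE k) eq_i eq_j interval_eltE.
Qed.
Definition wreath_perm (x : wreath 'S_a b) : 'S_(a * b) :=
  perm (@wreath_act_inj x).

Lemma wreath_permE x i j :
  wreath_perm x (interval_elt i j)
  = interval_elt (wperm x i) (wbase x (wperm x i) j).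
Proof. by rewrite permE /wreath_act interval_eltK1 interval_eltK2. Qed.

Fact wreath_permM : {in wr (Cyc a) b &, {morph wreath_perm : x y / (x * y)%g}}.
Proof.
move=> x y _ _; apply/permP=> k; rewrite -(interval_eltE k).
rewrite permM !wreath_permE wreathM1 wreathM2 !permM permK.
by [].
Qed.
Canonical wreath_perm_morphism := Morphism wreath_permM.

Hypothesis a_gt0 : (0 < a)%N.

Fact wreath_perm_inj : injective wreath_perm.
Proof.
pose j0 := Ordinal a_gt0.
move=> x y eq_xy.
have eqE i j : interval_elt (wperm x i) (wbase x (wperm x i) j)
             = interval_elt (wperm y i) (wbase y (wperm y i) j).
  by rewrite -!wreath_permE eq_xy.
have eq_s : wperm x = wperm y.
  by apply/permP=> i; have /(congr1 interval) := eqE i j0; rewrite !interval_eltK1.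
have eq_g : wbase x = wbase y.
  apply/ffunP=> i; apply/permP=> j.
  have /(congr1 offset) := eqE ((wperm y)^-1 i)%g j.
  by rewrite !interval_eltK2 eq_s permKV.
by case: x y eq_s eq_g {eq_xy eqE} => ? ? [? ?] /= -> ->.
Qed.

Definition wreath_image : {group 'S_(a * b)} :=
  (wreath_perm @* wr (Cyc a) b)%G.

Lemma wreath_perm_isom : isom (wr (Cyc a) b) wreath_image wreath_perm.
Proof.
apply/isomP; split=> //; apply/injmP.
exact: in2W wreath_perm_inj.
Qed.

End Embedding.

(* Main.v *)
Require Import Defs.
From HB Require Import structures.
From mathcomp Require Import all_boot all_order all_algebra.
From mathcomp Require Import all_fingroup cyclic algC.
From mathcomp Require Import mxrepresentation classfun character.
From mathcomp Require Import zify.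
From mathcomp Require Import mpoly.

(* By Frobenius reciprocity Ch phi = 1/n! \sum_g phi(g) p_g, where p_g is the *)
(* sum of x^cont(w) over the words w fixed by g, as soon as the Specht        *)
(* characters form the irreducible characters of S_n and the multiplicity of  *)
(* S^lam in the module of words of content m is the number of semistandard    *)
(* tableaux of shape lam and content m.  That multiplicity is the rank of the *)
(* Young idempotent on these words.  It is bounded above by straightening: a  *)
(* vector in its image is determined by its values on semistandard tableaux,  *)
(* by the Garnir relations.  It is bounded below because the images of the    *)
(* semistandard tableaux are triangular for \sum row * T.  Orthogonality of   *)
(* distinct Specht modules also follows from straightening, and completeness  *)
(* from the count of conjugacy classes by cycle types.                        *)
(*   Ch of an induced character is thus an average over the subgroup.  For    *)
(* C_a wr S_b, words of length a * b are b-tuples of words of length a. Fixing *)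
(* the permutation s and summing over the base group C_a^b, each position i   *)
(* contributes a character sum over the rotations carrying one word to        *)
(* another; it vanishes unless both lie in the same necklace and the frequency*)
(* divides the exponent of chi at i.  What remains is a sum over the tuples of*)
(* necklaces fixed by s, which factors over the blocks into the plethysms.    *)

Set Implicit Arguments.
Unset Strict Implicit.
Unset Printing Implicit Defensive.

Import GroupScope GRing.Theory Num.Theory.
Local Open Scope ring_scope.

(** * Straightening *)

(** Both sides become averages of fixed-point sums. On the left, [Ch_fixed_words] and two uses of
    Frobenius reciprocity ([sum_cfInd]) give the average over [wrY] of the inducing character times
    [fixed_words] ([Ch_Ind_Specht_wreath]). On the right, [plethysm_schur_enum] writes each factor
    as an average, over one symmetric group, of a Specht character times a sum over the tuples of
    necklaces fixed by a permutation. The two are matched for each block-preserving s by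
    [sum_rotations]. The sum over the base group is a product of sums [rotation_sum] over one
    rotation each; by [rotation_sumE] each is a coboundary times a stabiliser order times a
    condition on necklaces. The coboundaries cancel over all positions ([prod_rotation_sum]), and by
    orbit-stabiliser every admissible tuple of necklaces has total weight a^b ([sum_prod_stab]),
    which cancels against the order of the base group. [big_block_perm] and [big_block_ffun] then
    split the sum into blocks. The representation theory behind [Ch_fixed_words] rests on
    [straightening], which is used three times: to show that e x e is a multiple of the Young
    idempotent e ([young_multiple]), that e_mu x e_lam vanishes in one direction
    ([young_idem_conv_eq0]), and that the rank of e on words of given content is at most the number
    of semistandard tableaux ([kostka_mx_vanish]). *)

Section Words.

Variables (n N : nat).
Implicit Types (w : {ffun 'I_n -> 'I_N}) (g h : 'S_n).

Definition word_act w g : {ffun 'I_n -> 'I_N} := [ffun i => w (g i)].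

Lemma word_act1 w : word_act w 1%g = w.
Proof. by apply/ffunP=> i; rewrite ffunE perm1. Qed.

(** Permutations compose from left to right, so this is a left action; hence the inverses when words
    are later indexed by group elements. *)
Lemma word_actM w g h : word_act (word_act w g) h = word_act w (h * g)%g.
Proof. by apply/ffunP=> i; rewrite !ffunE permM. Qed.

Lemma word_actK g : cancel (word_act^~ g) (word_act^~ g^-1%g).
Proof. by move=> w; rewrite word_actM mulVg word_act1. Qed.

Lemma word_actKV g : cancel (word_act^~ g^-1%g) (word_act^~ g).
Proof. by move=> w; rewrite word_actM mulgV word_act1. Qed.

Lemma word_act_inj g : injective (word_act^~ g).
Proof. exact: can_inj (word_actK g). Qed.

End Words.

(** Rearrangement inequality: v / 2 separates the values that move to a larger f from those that
    move to a smaller one. So (f i - f (g i)) (2 t (g i) - v) is nonnegative and somewhere positive,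
    and the terms in v cancel in the sum. Doubling t keeps the threshold an integer. *)
Lemma weight_increase (n : nat) (f t : 'I_n -> nat) (g : 'S_n) (v : nat) :
    (forall i, f i != f (g i) -> if (f (g i) < f i)%N then (v < (t (g i)).*2)%N
                                 else ((t (g i)).*2 < v)%N) ->
    (exists i, f i != f (g i)) ->
  (\sum_i f i * t i < \sum_i f i * t (g i))%N.
Proof.
move=> ltv [i0 ne_i0].
have pos i : (f (g i) * (t (g i)).*2 + f i * v <= f i * (t (g i)).*2 + f (g i) * v
    ?= iff (f i == f (g i)))%N.
  apply/leqifP; case: eqP => [-> |/eqP/[dup] ne /ltv]; first by lia.
  by case: ltnP => ?; nia.
have strict : (\sum_i (f (g i) * (t (g i)).*2 + f i * v) <
        \sum_i (f i * (t (g i)).*2 + f (g i) * v))%N.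
  rewrite (bigD1 i0) //= [ltnRHS](bigD1 i0) //= -addSn leq_add //.
    by rewrite (ltn_leqif (pos i0)).
  by apply: leq_sum => i _; rewrite (pos i).
have re (F : 'I_n -> nat) : (\sum_i F (g i) = \sum_i F i)%N.
  by rewrite [RHS](reindex_inj (@perm_inj _ g)).
rewrite !big_split /= (re (fun i => f i * (t i).*2)%N) in strict.
rewrite -(re (fun i => f i * v)%N) ltn_add2r in strict.
rewrite -ltn_double -!mul2n !big_distrr /=.
by under eq_bigr do rewrite mulnCA mul2n;
   under [ltnRHS]eq_bigr do rewrite mulnCA mul2n.
Qed.

Section Tableau.

Variables (n : nat) (lam : seq nat).
Hypotheses (lam_part : is_partition lam) (sum_lam : sumn lam = n).

Local Notation row := (cell_row lam).
Local Notation col := (cell_col lam).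

Lemma cell_inj (i k : 'I_n) : row i = row k -> col i = col k -> i = k.
Proof.
move=> eq_r eq_c; apply: val_inj.
rewrite /= -[LHS](reshape_indexK lam) -[RHS](reshape_indexK lam).
exact: f_equal2 eq_r eq_c.
Qed.

Lemma nth_partition r s : (r <= s)%N -> (nth 0 lam s <= nth 0 lam r)%N.
Proof.
move=> le_rs; have [lt_s|/(nth_default 0%N)->//] := ltnP s (size lam).
have /andP[lam_sorted _] := lam_part.
have geq_trans : transitive geq by move=> x y z /= le1 le2; apply: leq_trans le2 le1.
have geq_refl : reflexive geq by move=> x; apply: leqnn.
by apply: (sorted_leq_nth geq_trans geq_refl 0%N lam_sorted) => //; apply: leq_ltn_trans lt_s.
Qed.

Lemma cell_below (k : 'I_n) r c : (r <= row k)%N -> (c <= col k)%N ->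
  exists2 i : 'I_n, row i = r & col i = c.
Proof.
move=> le_r le_c.
have lt_c : (c < nth 0 lam r)%N.
  apply: leq_trans (nth_partition le_r); apply: leq_ltn_trans le_c _.
  by apply: reshape_offsetP; rewrite sum_lam.
have lt_n := flatten_indexP lt_c; rewrite sum_lam in lt_n.
exists (Ordinal lt_n); first exact: flatten_indexKl.
exact: flatten_indexKr.
Qed.

(** This is [is_ssyt] with cells indexed by ['I_n], on which ['S_n] acts; the two are convertible
    once n is [sumn lam]. *)
Definition semistandard N (T : {ffun 'I_n -> 'I_N}) : bool :=
  [forall i : 'I_n, forall j : 'I_n,
     ((row i == row j) && (col i <= col j) ==> (T i <= T j))%N
  && ((col i == col j) && (row i < row j) ==> (T i < T j))%N].

Lemma semistandardP N (T : {ffun 'I_n -> 'I_N}) :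
  reflect ((forall i j : 'I_n, row i = row j -> (col i < col j)%N -> (T i <= T j)%N) /\
           (forall i j : 'I_n, col i = col j -> (row i < row j)%N -> (T i < T j)%N))
          (semistandard T).
Proof.
apply: (iffP forallP) => [ssT|[ssr ssc] i].
  split=> i j /eqP eq_ij lt_ij; have /forallP/(_ j)/andP[/implyP r /implyP c] := ssT i.
    by apply: r; rewrite eq_ij ltnW.
  by apply: c; rewrite eq_ij.
apply/forallP=> j; apply/andP; split; apply/implyP=> /andP[/eqP eq_ij].
  by rewrite leq_eqVlt => /predU1P[/(cell_inj eq_ij)->//|/(ssr _ _ eq_ij)].
exact: ssc.
Qed.

Lemma row_stab_group_set : group_set (row_stab n lam).
Proof.
apply/group_setP; split=> [|s t]; rewrite !inE.
  by apply/forallP=> i; rewrite perm1.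
move=> /forallP Rs /forallP Rt; apply/forallP=> i.
by rewrite permM (eqP (Rt _)).
Qed.
Canonical row_stab_group := Group row_stab_group_set.

Lemma col_stab_group_set : group_set (col_stab n lam).
Proof.
apply/group_setP; split=> [|s t]; rewrite !inE.
  by apply/forallP=> i; rewrite perm1.
move=> /forallP Rs /forallP Rt; apply/forallP=> i.
by rewrite permM (eqP (Rt _)).
Qed.
Canonical col_stab_group := Group col_stab_group_set.

Lemma row_stabP (s : 'S_n) : reflect (forall i : 'I_n, row (s i) = row i) (s \in row_stab n lam).
Proof. by rewrite inE; apply: (iffP forallP) => R_s i; apply/eqP/R_s. Qed.

Lemma col_stabP (s : 'S_n) : reflect (forall i : 'I_n, col (s i) = col i) (s \in col_stab n lam).
Proof. by rewrite inE; apply: (iffP forallP) => C_s i; apply/eqP/C_s. Qed.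

Definition col_weight N (T : {ffun 'I_n -> 'I_N}) := (\sum_(i < n) col i * T i)%N.
Definition row_weight N (T : {ffun 'I_n -> 'I_N}) := (\sum_(i < n) row i * T i)%N.

(** Otherwise swapping an inverted pair of a column would increase [row_weight], the threshold being
    the mean of its two entries. *)
Lemma sort_columns N (T : {ffun 'I_n -> 'I_N}) :
    (forall q, q \in col_stab n lam ->
       (row_weight (word_act T q) <= row_weight T)%N) ->
  forall i j : 'I_n, col i = col j -> (row i < row j)%N -> (T i <= T j)%N.
Proof.
clear lam_part sum_lam; move=> maxT i j eq_c lt_r; rewrite leqNgt; apply/negP=> lt_T.
pose q := tperm i j.
have Cq : q \in col_stab n lam.
  by apply/col_stabP=> k; rewrite /q; case: tpermP => // ->.
have := maxT q Cq; rewrite leqNgt => /negP[].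
rewrite /row_weight; under [ltnRHS]eq_bigr do rewrite ffunE.
apply: (@weight_increase _ row (fun i => T i) q (T i + T j)%N).
  move=> k; rewrite /q; case: tpermP => [->|->|_ _]; last by rewrite eqxx.
    by rewrite [(row j < _)%N]ltnNge ltnW //=; lia.
  by rewrite lt_r; lia.
by exists i; rewrite /q tpermL neq_ltn lt_r.
Qed.

Lemma col_weight_act N (T : {ffun 'I_n -> 'I_N}) q :
  q \in col_stab n lam -> col_weight (word_act T q) = col_weight T.
Proof.
move=> /col_stabP Cq; rewrite /col_weight [RHS](reindex_inj (@perm_inj _ q)) /=.
by apply: eq_bigr => i _; rewrite ffunE Cq.
Qed.

(* Antisymmetrising over Z kills the Young symmetrizer when every column      *)
(* permutation sends two elements of Z to the same row.                       *)
Definition garnir (Z : {set 'I_n}) : Prop :=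
  forall q, q \in col_stab n lam ->
    exists x y : 'I_n, [/\ x \in Z, y \in Z, x != y & row (q x) = row (q y)].

(** Pigeonhole: the two sets, the part of the left column from i down and the part of the right
    column down to k, have together more cells than the left column. A column permutation keeps them
    in their columns, and every row that meets the right column meets the left one. *)
Lemma garnir_descent (i k : 'I_n) : row i = row k -> (col i < col k)%N ->
  garnir ([set x : 'I_n | (col x == col i) && (row i <= row x)%N]
          :|: [set y : 'I_n | (col y == col k) && (row y <= row k)%N]).
Proof.
move=> eq_r lt_c q /col_stabP Cq.
set X := [set x | _]; set Y := [set y | _].
pose K := [set x : 'I_n | col x == col i].
(* The cell of column c in the row of x; [mvP] says when it exists. *)
pose mv c (x : 'I_n) : 'I_n := odflt x [pick y : 'I_n | (row y == row x) && (col y == c)].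
have mvP c (x z : 'I_n) : (row x <= row z)%N -> (c <= col z)%N ->
    row (mv c x) = row x /\ col (mv c x) = c.
  move=> le_r le_c; have [y yr yc] := cell_below le_r le_c.
  rewrite /mv; case: pickP => [y' /andP[/eqP-> /eqP->] //|/(_ y)].
  by rewrite yr yc !eqxx.
have dXY : [disjoint X & Y].
  rewrite -setI_eq0; apply/eqP/setP=> x; rewrite !inE.
  by apply/negP=> /andP[/andP[/eqP-> _] /andP[/eqP eq_c _]]; rewrite eq_c ltnn in lt_c.
have XK : X \subset K by apply/subsetP=> x; rewrite !inE => /andP[].
(* Sliding the cells above i to the column of k lands in Y and misses k. *)
have lt_KXY : (#|K :\: X| < #|Y|)%N.
  have mvI : {in K :\: X &, injective (mv (col k))}.
    move=> x y; rewrite !inE => /andP[xr /eqP xc] /andP[yr /eqP yc] eq_mv.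
    have ltr z : ~~ ((col z == col i) && (row i <= row z)%N) -> col z = col i -> (row z <= row k)%N.
      by move=> + zc; rewrite zc eqxx /= -ltnNge eq_r => /ltnW.
    have [rx _] := mvP (col k) x k (ltr x xr xc) (leqnn _).
    have [ry _] := mvP (col k) y k (ltr y yr yc) (leqnn _).
    by apply: cell_inj; rewrite ?xc // -rx eq_mv ry.
  rewrite -(card_in_imset mvI) [X in (_ < X)%N](cardsD1 k) inE eqxx leqnn /= add1n ltnS.
  apply/subset_leq_card/subsetP=> _ /imsetP[x xKX ->].
  move: xKX; rewrite !inE => /andP[+ /eqP xc]; rewrite xc eqxx /= -ltnNge => xr.
  have [|rx cx] := mvP (col k) x k _ (leqnn _); first by rewrite -eq_r ltnW.
  rewrite rx cx eqxx -eq_r ltnW //= andbT.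
  by apply: contraTneq xr => eq_k; rewrite -rx eq_k eq_r ltnn.
have ltK : (#|K| < #|X :|: Y|)%N.
  rewrite cardsU disjoint_setI0 // cards0 subn0 -(cardsID X K).
  by rewrite (setIidPr XK) ltn_add2l.
pose f x := mv (col i) (q x).
have fP x : x \in X :|: Y -> row (f x) = row (q x) /\ col (f x) = col i.
  move=> xXY; apply: (mvP _ _ (q x)) => //; rewrite Cq.
  move: xXY; rewrite !inE => /orP[/andP[/eqP-> _]//|/andP[/eqP-> _]].
  exact: ltnW.
have [/dinjectiveP f_inj|/dinjectivePn[x xZ [y /andP[ne_xy yZ] eq_f]]] :=
    boolP (dinjectiveb f (mem (X :|: Y))).
  move: ltK; rewrite ltnNge -(card_in_imset f_inj) => /negP[].
  apply/subset_leq_card/subsetP=> _ /imsetP[x xXY ->].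
  by rewrite inE; have [_ ->] := fP x xXY.
exists x, y; split=> //; first by rewrite eq_sym.
by rewrite -(fP x xZ).1 -(fP y yZ).1 eq_f.
Qed.

(* Take T with m T <> 0 maximising \sum col * T, then sort its                *)
(* columns.  If T had a row descent, the Garnir relation of garnir_descent    *)
(* would express m T by values of m at words of larger weight.                *)
Lemma straightening N (m : {ffun 'I_n -> 'I_N} -> algC) :
    (forall q w, q \in col_stab n lam -> m (word_act w q) = (-1) ^+ odd_perm q * m w) ->
    (forall Z w, garnir Z ->
       \sum_(g in Sym Z) (-1) ^+ odd_perm g * m (word_act w g) = 0) ->
    (forall T, semistandard T -> m T = 0) ->
  forall w, m w = 0.
Proof.
move=> mC mG m_ss w0; apply/eqP/negPn/negP=> nz_w0.
pose T0 := [arg max_(T > w0 | m T != 0) col_weight T].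
have [nzT0 maxT0] : m T0 != 0 /\
    forall T, m T != 0 -> (col_weight T <= col_weight T0)%N.
  by rewrite /T0; case: arg_maxnP.
pose q := [arg max_(q > 1%g | q \in col_stab n lam) row_weight (word_act T0 q)].
have [Cq maxq] : q \in col_stab n lam /\ forall q', q' \in col_stab n lam ->
    (row_weight (word_act T0 q') <= row_weight (word_act T0 q))%N.
  by rewrite /q; case: arg_maxnP => //; apply: group1.
set T := word_act T0 q in maxq.
have nzT : m T != 0 by rewrite mC // mulf_neq0 ?signr_eq0.
have maxT T' : (col_weight T < col_weight T')%N -> m T' = 0.
  by rewrite col_weight_act // => ltT; apply/eqP/negPn/negP => /maxT0; rewrite leqNgt ltT.
have sortT : forall i j : 'I_n, col i = col j -> (row i < row j)%N -> (T i <= T j)%N.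
  by apply: sort_columns => q' Cq'; rewrite word_actM maxq ?groupM.
have /negP[] := nzT; apply/eqP/m_ss/semistandardP; split=> i k; last first.
  (* Two equal entries in a column would give m T = - m T. *)
  move=> eq_c lt_r; rewrite ltn_neqAle sortT // andbT; apply: contra nzT => /eqP eq_T.
  have Ct : tperm i k \in col_stab n lam.
    by apply/col_stabP=> x; case: tpermP => // ->.
  have ne_ik : i != k by apply: contraTneq lt_r => ->; rewrite ltnn.
  have := mC _ T Ct; rewrite odd_tperm ne_ik expr1 mulN1r.
  have -> : word_act T (tperm i k) = T.
    by apply/ffunP=> x; rewrite ffunE; case: tpermP => // ->; apply: val_inj.
  by move/eqP; rewrite -addr_eq0 -mulr2n mulrn_eq0.
move=> eq_r lt_c; rewrite leqNgt; apply: contra nzT => lt_T.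
have := mG _ T (garnir_descent eq_r lt_c); set Z := _ :|: _.
(* In the Garnir relation each column permutation contributes m T, and every other term vanishes by
   maximality of the weight of T. *)
rewrite (bigID (mem (col_stab n lam))) /= [X in _ + X]big1 => [|g /andP[ZG Cg]].
  rewrite addr0 (eq_bigr (fun=> m T)) => [|g /andP[_ Cg]]; last first.
    by rewrite mC // mulrA -expr2 sqrr_sign mul1r.
  rewrite sumr_const => /eqP; rewrite mulrn_eq0 => /orP[|//].
  by move=> /eqP/card0_eq/(_ 1%g); rewrite unfold_in /= !group1.
rewrite maxT ?mulr0 // /col_weight; under [ltnRHS]eq_bigr do rewrite ffunE.
have {}ZG : perm_on Z g by rewrite inE in ZG.
(* The entries of Z in the column of k are at most T k, those in the column of i at least T i > T k;
   the mean of T i and T k separates them. *)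
apply: (@weight_increase _ col (fun i => T i) g (T i + T k)%N) => [x ne_x|]; last first.
  apply/existsP; rewrite -negb_forall; apply: contra Cg => /forallP Cg.
  by apply/col_stabP=> x; rewrite -(eqP (Cg x)).
have Zx : x \in Z by apply: contraR ne_x => /(out_perm ZG)->.
have Zgx : g x \in Z by rewrite perm_closed.
have leX (y : 'I_n) : col y = col i -> (row i <= row y)%N -> (T i <= T y)%N.
  move=> eq_c; rewrite leq_eqVlt => /predU1P[eq_ry|]; last exact/sortT/esym.
  by rewrite (cell_inj eq_ry (esym eq_c)).
have leY (y : 'I_n) : col y = col k -> (row y <= row k)%N -> (T y <= T k)%N.
  move=> eq_c; rewrite leq_eqVlt => /predU1P[eq_ry|]; last exact: sortT.
  by rewrite (cell_inj eq_ry eq_c).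
move: Zx Zgx ne_x; rewrite !inE.
case/orP=> /andP[/eqP -> _] /orP[] /andP[/eqP eq_c le_r]; rewrite ?eq_c ?eqxx // => _.
  rewrite ltnNge (ltnW lt_c) /=.
  by have := leY _ eq_c le_r; lia.
by rewrite lt_c; have := leX _ eq_c le_r; lia.
Qed.

End Tableau.
(** * The Young symmetrizer *)

(* A function x stands for the element \sum_g x g g of the group algebra, in  *)
(* which conv is the product.                                                 *)
Section Convolution.

Variable gT : finGroupType.
Implicit Types (x y z : {ffun gT -> algC}) (g h : gT).

Definition conv x y : {ffun gT -> algC} := [ffun g => \sum_h x h * y (h^-1 * g)%g].
Definition shift h x : {ffun gT -> algC} := [ffun g => x (h^-1 * g)%g].
Definition scale (a : algC) x : {ffun gT -> algC} := [ffun g => a * x g].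
Definition star x : {ffun gT -> algC} := [ffun g => x g^-1%g].

Lemma scaleE a x g : scale a x g = a * x g.
Proof. by rewrite ffunE. Qed.

Lemma shiftE h x g : shift h x g = x (h^-1 * g)%g.
Proof. by rewrite ffunE. Qed.

Lemma sub_scaleE a x y g : (x - scale a y) g = x g - a * y g.
Proof. by rewrite !ffunE. Qed.

Lemma convE x y g : conv x y g = \sum_h x h * y (h^-1 * g)%g.
Proof. by rewrite ffunE. Qed.

Lemma convEr x y g : conv x y g = \sum_h x (g * h^-1)%g * y h.
Proof.
rewrite convE (reindex_inj invg_inj) (reindex_inj (mulIg g^-1)%g) /=.
by apply: eq_bigr => h _; rewrite !(invMg, invgK) mulgKV.
Qed.

Lemma convA x y z : conv x (conv y z) = conv (conv x y) z.
Proof.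
apply/ffunP=> g; rewrite !convE.
under eq_bigr do rewrite convE mulr_sumr.
under [RHS]eq_bigr do rewrite convE mulr_suml.
rewrite [RHS]exchange_big /=; apply: eq_bigr => h _.
rewrite [RHS](reindex_inj (mulgI h)) /=; apply: eq_bigr => k _.
by rewrite mulKg invMg !mulgA mulrA.
Qed.

Lemma conv_shift x y z g : conv x (conv y z) g = \sum_h y h * conv x (shift h z) g.
Proof.
rewrite convE; under eq_bigr do rewrite convE mulr_sumr.
rewrite exchange_big; apply: eq_bigr => h _.
rewrite convE mulr_sumr; apply: eq_bigr => k _.
by rewrite shiftE mulrCA.
Qed.

Lemma shift_conv h x : shift h x = conv [ffun g => (g == h)%:R] x.
Proof.
apply/ffunP=> g; rewrite shiftE convE (bigD1 h) //= ffunE eqxx mul1r.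
by rewrite big1 ?addr0 // => k /negbTE ne_k; rewrite ffunE ne_k mul0r.
Qed.

Lemma convZl a x y : conv (scale a x) y = scale a (conv x y).
Proof.
apply/ffunP=> g; rewrite [RHS]ffunE !convE [RHS]mulr_sumr.
by apply: eq_bigr => h _; rewrite ffunE mulrA.
Qed.

Lemma convZr a x y : conv x (scale a y) = scale a (conv x y).
Proof.
apply/ffunP=> g; rewrite [RHS]ffunE !convE [RHS]mulr_sumr.
by apply: eq_bigr => h _; rewrite ffunE mulrCA.
Qed.

Lemma conv0l y : conv 0 y = 0.
Proof. by apply/ffunP=> g; rewrite convE ffunE big1 // => h _; rewrite ffunE mul0r. Qed.

Lemma star_conv x y : star (conv x y) = conv (star y) (star x).
Proof.
apply/ffunP=> g; rewrite ffunE convE convEr (reindex_inj invg_inj) /=.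
by apply: eq_bigr => h _; rewrite !ffunE invMg !invgK mulrC.
Qed.

(** The value of x x^* at 1 is a sum of squares of reals. *)
Lemma conv_star_eq0 x : (forall g, x g \is Num.real) -> conv x (star x) = 0 -> x = 0.
Proof.
move=> x_real /ffunP/(_ 1%g); rewrite convE ffunE => /eqP sum0; apply/ffunP=> g.
move: sum0; under eq_bigr do rewrite ffunE mulg1 invgK -expr2.
rewrite psumr_eq0 => [/allP/(_ g)|h _]; last by rewrite real_exprn_even_ge0.
by rewrite mem_index_enum => /(_ isT); rewrite sqrf_eq0 ffunE => /eqP.
Qed.

Lemma conv_real x y : (forall g, x g \is Num.real) -> (forall g, y g \is Num.real) ->
  forall g, conv x y g \is Num.real.
Proof. by move=> xR yR g; rewrite convE rpred_sum // => h _; rewrite rpredM. Qed.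

End Convolution.

Section YoungSymmetrizer.

Variables (n : nat) (lam : seq nat).
Hypotheses (lam_part : is_partition lam) (sum_lam : sumn lam = n).
Implicit Types (x y z : {ffun 'S_n -> algC}) (g h p q : 'S_n).

Local Notation R := (row_stab n lam).
Local Notation C := (col_stab n lam).

Definition row_sum : {ffun 'S_n -> algC} := [ffun g => (g \in R)%:R].
Definition col_sum : {ffun 'S_n -> algC} := [ffun g => (g \in C)%:R * (-1) ^+ odd_perm g].
Definition young := conv row_sum col_sum.

Lemma youngE g :
  young g = \sum_(q in C) (-1) ^+ odd_perm q * (g * q^-1 \in R)%g%:R.
Proof.
rewrite /young convEr [RHS]big_mkcond; apply: eq_bigr => q _; rewrite !ffunE mulrC.
by case: ifP; rewrite ?mul1r ?mul0r.
Qed.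

(** Only the identity preserves both rows and columns. *)
Lemma young1 : young 1%g = 1.
Proof.
rewrite youngE (bigD1 1%g) ?group1 //= invg1 mulg1 group1 odd_perm1 mulr1 big1 ?addr0 //.
move=> q /andP[Cq nt_q]; rewrite mul1g groupV /=.
case: row_stabP; rewrite ?mulr0 // => Rq; case/eqP: nt_q.
move/col_stabP in Cq; apply/permP=> i; rewrite perm1; exact: cell_inj (Rq i) (Cq i).
Qed.

Lemma young_row p g : p \in R -> young (p * g)%g = young g.
Proof.
move=> Rp; rewrite !youngE; apply: eq_bigr => q _.
by rewrite -mulgA groupMl.
Qed.

(* Satisfied by the elements of the left ideal generated by the symmetrizer.  *)
Definition young_relations x : Prop :=
  (forall q g, q \in C -> x (g * q^-1)%g = (-1) ^+ odd_perm q * x g) /\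
  (forall Z g, garnir lam Z ->
     \sum_(s in Sym Z) (-1) ^+ odd_perm s * x (g * s^-1)%g = 0).

(** For the Garnir relation, fix q: two elements of Z are sent to one row by q^-1. Their
    transposition changes the sign, while its conjugate by q is a row permutation and is absorbed,
    so the sum is its own opposite. *)
Lemma young_relations_young : young_relations young.
Proof.
split=> [q g Cq | Z g gZ].
  rewrite !youngE mulr_sumr (reindex_inj (mulIg q^-1)%g) /=.
  apply: eq_big => [k|k _]; first by rewrite groupMr ?groupV.
  by rewrite odd_permM odd_permV signr_addb mulrCA mulrA invMg invgK mulgA mulgKV.
under eq_bigr do rewrite youngE mulr_sumr.
rewrite exchange_big big1 //= => q Cq.
have [//|x [y [xZ yZ ne_xy eq_r]]] := gZ q^-1%g _; first by rewrite groupV.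
set S := \sum_(s in _) _.
have SN : S = - S.
  rewrite {1}/S (reindex_inj (mulgI (tperm x y))) -sumrN /=.
  have Zt : tperm x y \in Sym Z.
    rewrite inE; apply/subsetP=> k; rewrite inE.
    by case: tpermP => [->|->|]; rewrite ?eqxx.
  apply: eq_big => [s|s _]; first by rewrite groupMl.
  rewrite odd_permM odd_tperm ne_xy addTb signrN -!mulNr; congr (_ * (_ * _%:R)).
  rewrite invMg tpermV -!mulgA.
  suffices Rt : (q * tperm x y * q^-1)%g \in R.
    have -> : (g * (s^-1 * (tperm x y * q^-1)) =
       (g * (s^-1 * q^-1)) * (q * tperm x y * q^-1))%g by rewrite !mulgA mulgKV.
    by rewrite groupMr.
  have -> : (q * tperm x y * q^-1 = tperm (q^-1 x) (q^-1 y))%g.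
    by rewrite -tpermJ /conjg invgK mulgA.
  by apply/row_stabP=> k; case: tpermP => // ->.
by apply/eqP; rewrite -[_ == 0](mulrn_eq0 _ 2) /= mulr2n addr_eq0 -SN.
Qed.

Lemma young_relations_conv x y : young_relations y -> young_relations (conv x y).
Proof.
case=> yC yG; split=> [q g Cq | Z g gZ].
  rewrite !convE mulr_sumr; apply: eq_bigr => h _.
  by rewrite mulgA yC // mulrCA.
under eq_bigr do rewrite convE mulr_sumr.
rewrite exchange_big big1 //= => h _.
under eq_bigr do rewrite mulrCA mulgA.
by rewrite -mulr_sumr yG // mulr0.
Qed.

Lemma young_relationsB a x y :
  young_relations x -> young_relations y -> young_relations (x - scale a y).
Proof.
case=> xC xG [yC yG]; split=> [q g Cq | Z g gZ].
  by rewrite !ffunE xC // yC // mulrBr mulrCA.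
transitivity (\sum_(s in Sym Z) (-1) ^+ odd_perm s * x (g * s^-1)%g
   - a * \sum_(s in Sym Z) (-1) ^+ odd_perm s * y (g * s^-1)%g).
  rewrite mulr_sumr -sumrB; apply: eq_bigr => s _.
  by rewrite !ffunE mulrBr mulrCA.
by rewrite xG // yG // mulr0 subr0.
Qed.

End YoungSymmetrizer.

(** * Functions on the group as functions on words *)

Section RowWord.

Variables (n : nat) (mu : seq nat).
Hypothesis sum_mu : sumn mu = n.

Fact row_word_subproof (i : 'I_n) : (cell_row mu i < size mu)%N.
Proof. by apply: reshape_indexP; rewrite sum_mu. Qed.
(** Its stabiliser is the row stabiliser of [mu], so functions on ['S_n] invariant under that group
    on the left are functions on the orbit of this word. *)
Definition row_word : {ffun 'I_n -> 'I_(size mu)} :=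
  [ffun i => Ordinal (row_word_subproof i)].

Lemma row_wordE i : row_word i = cell_row mu i :> nat.
Proof. by rewrite ffunE. Qed.

Lemma row_word_stab g : (word_act row_word g == row_word) = (g \in row_stab n mu).
Proof.
apply/eqP/row_stabP=> [/ffunP eq_g i|Rg].
  by have := congr1 val (eq_g i); rewrite ffunE /= !row_wordE.
by apply/ffunP=> i; apply: val_inj; rewrite ffunE /= !row_wordE.
Qed.

Lemma card_row r : #|[set i : 'I_n | cell_row mu i == r]| = nth 0%N mu r.
Proof.
have lt_n (c : 'I_(nth 0%N mu r)) : (flatten_index mu r c < n)%N.
  by rewrite -sum_mu flatten_indexP.
pose f c := Ordinal (lt_n c).
have f_inj : injective f.
  move=> c d /(congr1 (fun i : 'I_n => cell_col mu i)).
  by rewrite /cell_col !flatten_indexKr // => /val_inj.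
rewrite -[RHS]card_ord -cardsT -(card_imset _ f_inj); apply: eq_card => i.
rewrite inE; apply/eqP/imsetP=> [eq_r|[c _ ->]]; last exact: flatten_indexKl.
have lt_c : (cell_col mu i < nth 0%N mu r)%N.
  by rewrite -eq_r; apply: reshape_offsetP; rewrite sum_mu.
exists (Ordinal lt_c) => //; apply: val_inj.
by rewrite /= -eq_r; rewrite [RHS]reshape_indexK.
Qed.

Variable lam : seq nat.
Hypotheses (lam_part : is_partition lam) (sum_lam : sumn lam = n).

(** By row invariance x descends to a function m on the orbit of [row_word]; extended by 0 it still
    satisfies the relations, and [straightening] applies. *)
Lemma young_relations_vanish (x : {ffun 'S_n -> algC}) :
    (forall p g, p \in row_stab n mu -> x (p * g)%g = x g) ->
    young_relations lam x ->
    (forall g, semistandard lam (word_act row_word g^-1%g) -> x g = 0) ->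
  x = 0.
Proof.
move=> xR [xC xG] x_ss.
pose m w := if [pick g | w == word_act row_word g^-1%g] is Some g then x g else 0.
have mE g : m (word_act row_word g^-1%g) = x g.
  rewrite /m; case: pickP => [h /eqP|/(_ g)]; last by rewrite eqxx.
  move/(congr1 (@word_act _ _ ^~ g)); rewrite word_actKV word_actM => /esym/eqP.
  rewrite row_word_stab => Rgh.
  by rewrite -(xR _ h Rgh) mulgKV.
have m0 w : (forall g, w != word_act row_word g^-1%g) -> m w = 0.
  by rewrite /m; case: pickP => // g /eqP-> /(_ g)/eqP.
have wP w : {g | w = word_act row_word g^-1%g} + {forall g, w != word_act row_word g^-1%g}.
  case: (pickP (fun g => w == word_act row_word g^-1%g)) => [g /eqP|no]; first by left; exists g.
  by right=> g; rewrite no.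
have wN w q : (forall g, w != word_act row_word g^-1%g) ->
    forall g, word_act w q != word_act row_word g^-1%g.
  move=> no g; apply: contra (no (g * q)%g) => /eqP/(congr1 (@word_act _ _ ^~ q^-1%g)).
  by rewrite word_actK word_actM invMg => ->.
apply/ffunP=> g; rewrite [RHS]ffunE -mE.
apply: (straightening lam_part sum_lam) => {g} [q w Cq|Z w gZ|T ssT].
- have [[g ->]|no] := wP w; last by rewrite !m0 ?mulr0 //; apply: wN.
  by rewrite word_actM -[q]invgK -invMg !mE xC ?invgK.
- have [[g ->]|no] := wP w; last by rewrite big1 // => s _; rewrite m0 ?mulr0 //; apply: wN.
  rewrite -[RHS](xG _ g gZ); apply: eq_bigr => s _.
  by rewrite word_actM -{2}[s]invgK -invMg mE.
have [[g eq_T]|/m0//] := wP T; rewrite eq_T mE x_ss //.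
by rewrite -eq_T.
Qed.

End RowWord.
Section SemistandardContent.

Variables (n : nat) (lam mu : seq nat).
Hypotheses (lam_part : is_partition lam) (sum_lam : sumn lam = n).
Hypotheses (mu_part : is_partition mu) (sum_mu : sumn mu = n).

(** Columns increase strictly and letters start at 0. *)
Lemma semistandard_row N (T : {ffun 'I_n -> 'I_N}) (i : 'I_n) :
  semistandard lam T -> (cell_row lam i <= T i)%N.
Proof.
case/semistandardP=> _ ssT; suff: forall r (k : 'I_n), cell_row lam k = r -> (r <= T k)%N by exact.
elim=> // r IHr {}i eq_r.
have [||k kr kc] := @cell_below _ _ lam_part sum_lam i r (cell_col lam i) => //.
  by rewrite eq_r.
by apply: leq_ltn_trans (IHr _ kr) _; apply: ssT; rewrite // kr eq_r.
Qed.

(** Sum [semistandard_row] over all cells. The total of the row indices replaces the dominance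
    order; as a number it compares any two partitions. *)
Lemma semistandard_content (g : 'S_n) :
    semistandard lam (word_act (row_word sum_mu) g) ->
  (\sum_(i < n) cell_row lam i <= \sum_(i < n) cell_row mu i
     ?= iff [forall i : 'I_n, cell_row mu (g i) == cell_row lam i])%N.
Proof.
move=> ssT; rewrite [X in (_ <= X ?= iff _)%N](reindex_inj (@perm_inj _ g)) /=.
rewrite (eq_forallb (P2 := fun i : 'I_n => cell_row lam i == cell_row mu (g i))).
  apply: leqif_sum => i _; apply/leqif_eq.
  by have := semistandard_row i ssT; rewrite ffunE row_wordE.
by move=> i; rewrite eq_sym.
Qed.

Lemma partition_eq (g : 'S_n) :
  (forall i : 'I_n, cell_row mu (g i) = cell_row lam i) -> lam = mu.
Proof.
move=> eq_g.
have eq_nth r : nth 0%N lam r = nth 0%N mu r.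
  rewrite -(card_row sum_lam r) -(card_row sum_mu r).
  rewrite -(card_imset _ (@perm_inj _ g)); apply: eq_card => i.
  rewrite inE -[i](permKV g) mem_imset ?inE ?eq_g //; exact: perm_inj.
(* Parts are nonzero, so the default 0 of [nth] detects the length. *)
have szP (l1 l2 : seq nat) : is_partition l2 -> nth 0%N l1 =1 nth 0%N l2 ->
    (size l2 <= size l1)%N.
  move=> /andP[_ l2_nz] eq12; rewrite leqNgt; apply: contra l2_nz => lt12.
  by rewrite -(nth_default 0%N (leqnn (size l1))) eq12 mem_nth.
apply: (@eq_from_nth _ 0%N) => [|i _]; last exact: eq_nth.
apply/eqP; rewrite eqn_leq !szP // => i; exact/esym/eq_nth.
Qed.

End SemistandardContent.

Section YoungIdempotent.

Variables (n : nat) (lam : seq nat).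
Hypotheses (lam_part : is_partition lam) (sum_lam : sumn lam = n).
Implicit Types (x y z : {ffun 'S_n -> algC}) (g h p q : 'S_n).

Local Notation young := (young n lam).

(** The difference satisfies the hypotheses of [young_relations_vanish] with [mu] = [lam]. The only
    semistandard tableau of shape and content [lam] comes from the row stabiliser, where the
    difference is its value at 1, namely 0. *)
Lemma young_multiple x :
    (forall p g, p \in row_stab n lam -> x (p * g)%g = x g) ->
    young_relations lam x ->
  x = scale (x 1%g) young.
Proof.
move=> xR xrel; apply/eqP; rewrite -subr_eq0; apply/eqP.
have yR : forall p g, p \in row_stab n lam ->
    (x - scale (x 1%g) young) (p * g)%g = (x - scale (x 1%g) young) g.
  by move=> p g Rp; rewrite !sub_scaleE xR // young_row.
have vanish := young_relations_vanish (sum_mu := sum_lam) lam_part sum_lam yR.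
apply: vanish => [|g ssg].
  by apply: young_relationsB => //; apply: young_relations_young.
have /leqifP := semistandard_content lam_part sum_lam ssg.
case: forallP => [Rg _|_]; last by rewrite ltnn.
have {}Rg : g^-1%g \in row_stab n lam by apply/row_stabP => i; apply/eqP.
by rewrite -(yR _ g Rg) mulVg sub_scaleE young1 mulr1 subrr.
Qed.

Lemma conv_row_stab x y p g : (forall p g, p \in row_stab n lam -> x (p * g)%g = x g) ->
  p \in row_stab n lam -> conv x y (p * g)%g = conv x y g.
Proof.
move=> xR Rp; rewrite !convE (reindex_inj (mulgI p)) /=.
by apply: eq_bigr => h _; rewrite xR // invMg mulgA mulgKV.
Qed.

Lemma young_conv x : conv young (conv x young) = scale (conv young (conv x young) 1%g) young.
Proof.
apply: young_multiple => [p g|].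
  by apply: conv_row_stab => *; apply: young_row.
by do 2!apply: young_relations_conv; apply: young_relations_young.
Qed.

Lemma row_sum_real g : row_sum n lam g \is Num.real.
Proof. by rewrite ffunE realn. Qed.

Lemma col_sum_real g : col_sum n lam g \is Num.real.
Proof. by rewrite ffunE rpredM ?realn // rpredX // rpredN rpred1. Qed.

Lemma young_real g : young g \is Num.real.
Proof. exact: conv_real row_sum_real col_sum_real _. Qed.

Lemma star_row_sum : star (row_sum n lam) = row_sum n lam.
Proof. by apply/ffunP=> g; rewrite !ffunE groupV. Qed.

Lemma star_col_sum : star (col_sum n lam) = col_sum n lam.
Proof. by apply/ffunP=> g; rewrite !ffunE groupV odd_permV. Qed.

Lemma conv_row_sum :
  conv (row_sum n lam) (row_sum n lam) = scale #|row_stab n lam|%:R (row_sum n lam).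
Proof.
apply/ffunP=> g; rewrite convE ffunE -sum1_card natr_sum [in RHS]big_mkcond mulr_suml /=.
apply: eq_bigr => h _; rewrite !ffunE; case: ifP => Rh; last by rewrite !mul0r.
by rewrite groupMl ?groupV.
Qed.

Lemma conv_col_sum :
  conv (col_sum n lam) (col_sum n lam) = scale #|col_stab n lam|%:R (col_sum n lam).
Proof.
apply/ffunP=> g; rewrite convE ffunE -sum1_card natr_sum [in RHS]big_mkcond mulr_suml /=.
apply: eq_bigr => h _; rewrite !ffunE; case: ifP => Rh; last by rewrite !mul0r.
by rewrite groupMl ?groupV // odd_permM odd_permV signr_addb !mul1r mulrCA signrMK.
Qed.

(** Classically the product of the hook lengths of [lam]. *)
Definition young_scale : algC := conv young young 1%g.

Lemma conv_young : conv young young = scale young_scale young.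
Proof.
apply: young_multiple => [p g|].
  by apply: conv_row_stab => *; apply: young_row.
by apply: young_relations_conv; apply: young_relations_young.
Qed.

(* With a, b the row and column sums, c = ab and (x, y) |-> (x y^* )(1) being *)
(* positive definite, cc = 0 would give (aba)(aba)^* = |R| (cc) a = 0 and then*)
(* c c^* = |C| aba = 0.                                                       *)
Lemma young_scale_neq0 : young_scale != 0.
Proof.
apply/eqP=> k0; have yy0 : conv young young = 0.
  by rewrite conv_young k0; apply/ffunP=> g; rewrite !ffunE mul0r.
set a := row_sum n lam; set b := col_sum n lam.
have scale0 k : scale k 0 = 0 :> {ffun 'S_n -> algC}.
  by apply/ffunP=> g; rewrite !ffunE mulr0.
have aba0 : conv young a = 0.
  apply: conv_star_eq0; first exact: conv_real young_real row_sum_real.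
  rewrite !star_conv star_row_sum star_col_sum -/a -/b (convA a b a) -(convA young a).
  rewrite (convA a (conv a b)) (convA a a b) conv_row_sum !convZl convZr.
  by rewrite -/young (convA young young) yy0 conv0l scale0.
have y0 : young = 0.
  apply: conv_star_eq0; first exact: young_real.
  rewrite star_conv star_row_sum star_col_sum /young -/a -/b -convA (convA b b).
  by rewrite conv_col_sum convZl convZr convA -/a -/b aba0 scale0.
by have /eqP := young1 n lam; rewrite y0 ffunE eq_sym oner_eq0.
Qed.

Definition young_idem := scale young_scale^-1 young.

Lemma young_idemK : conv young_idem young_idem = young_idem.
Proof.
rewrite convZl convZr conv_young; apply/ffunP=> g.
by rewrite !scaleE mulKf ?young_scale_neq0.
Qed.

Lemma young_relations_idem : young_relations lam young_idem.
Proof.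
(* The idempotent is read as 0 - (- k^-1) c, with 0 obtained as the convolution of 0 and c. *)
have := young_relationsB (- young_scale^-1)
  (@young_relations_conv n lam 0 _ (young_relations_young n lam)) (young_relations_young n lam).
rewrite conv0l; congr (young_relations lam); apply/ffunP=> g.
by rewrite sub_scaleE scaleE mulNr opprK ffunE add0r.
Qed.

Lemma young_idem_conv x :
  exists t, conv young_idem (conv x young_idem) = scale t young_idem.
Proof.
have := young_conv x; set t := conv _ _ 1%g => eq_t; exists (young_scale^-1 * t).
rewrite convZl !convZr eq_t; apply/ffunP=> g.
by rewrite !scaleE -mulrA; congr (_ * _); rewrite mulrCA.
Qed.

End YoungIdempotent.
(** * Characters of the Specht modules *)

(** [P] projects onto [U]. Factor it through a basis B of [U]: since B intertwines the two actions,
    cyclicity of the trace moves the computation to [U]. *)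
Lemma trace_submod_repr (F : fieldType) (gT : finGroupType) (G : {group gT}) (n : nat)
    (rG : mx_representation F G n) (U P : 'M[F]_n) (modU : mxmodule rG U) (g : gT) :
    g \in G -> (P <= U)%MS -> U *m P = U ->
  \tr (submod_repr modU g) = \tr (P *m rG g).
Proof.
move=> Gg sPU UP; set S := submod_repr modU; pose B := val_submod (1%:M : 'M_(\rank U)).
have BP : B *m P = B.
  have /submxP[X defB] : (B <= U)%MS by apply: val_submodP.
  by rewrite defB -mulmxA UP.
have BQ : B *m in_submod U P = 1%:M.
  by rewrite in_submodE mulmxA BP -in_submodE val_submodK.
have BS : B *m rG g = S g *m B by rewrite -val_submodJ // mul1mx -val_submodE.
rewrite -{1}(in_submodK sPU) val_submodE -mulmxA -/B BS [in RHS]mxtrace_mulC -mulmxA BQ.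
by rewrite mulmx1.
Qed.

Lemma trace_idempotent (F : fieldType) (n : nat) (E : 'M[F]_n) :
  E *m E = E -> \tr E = (\rank E)%:R.
Proof.
move=> EE; have EB := mulmx_base E.
suffices RC : row_base E *m col_base E = 1%:M by rewrite -{1}EB mxtrace_mulC RC mxtrace1.
apply: (row_full_inj (col_base_full E)); apply: (row_free_inj (row_base_free E)).
by rewrite mulmx1 mulmxA EB -mulmxA EB EE.
Qed.

Section SpechtCharacter.

Variables (n : nat) (lam : seq nat).
Hypotheses (lam_part : is_partition lam) (sum_lam : sumn lam = n).

Local Notation G := [set: 'S_n].
Local Notation aG := (regular_repr algC G).
Local Notation idx := (gring_index G).
Local Notation v := (young_symmetrizer n lam).
Local Notation e := (young_idem n lam).
Local Notation val := (@enum_val _ (mem G)).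

Lemma idx_bij : bijective idx.
Proof.
exists val => [g|i]; last exact: gring_valK.
by rewrite gring_indexK // inE.
Qed.

Lemma mulmx_regular m (A : 'M[algC]_(m, #|G|)) g i j :
  (A *m aG g) i j = A i (idx (enum_val j * g^-1)%g).
Proof.
rewrite !mxE (bigD1 (idx (enum_val j * g^-1)%g)) //= big1 ?addr0 => [|k ne_k].
  by rewrite !mxE gring_indexK ?inE // mulgKV gring_valK !eqxx mulr1.
rewrite !mxE eqxx /=; case: eqP => [eq_j|_]; last by rewrite mulr0.
by case/eqP: ne_k; rewrite eq_j gring_indexK ?inE // mulgK gring_valK.
Qed.

Lemma regular_mulmx m (A : 'M[algC]_(#|G|, m)) g i j :
  (aG g *m A) i j = A (idx (enum_val i * g)%g) j.
Proof.
rewrite mxE (bigD1 (idx (enum_val i * g)%g)) //= big1 ?addr0 => [|k ne_k].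
  by rewrite !mxE !eqxx mul1r.
by rewrite !mxE (negbTE ne_k) andbF mul0r.
Qed.

Lemma young_symmetrizerE j : v 0 j = young n lam (enum_val j).
Proof.
rewrite /young_symmetrizer exchange_big summxE youngE; apply: eq_bigr => q _ /=.
rewrite summxE.
under eq_bigr => p _.
  rewrite !mxE. rewrite eqxx /=.
  have -> : (j == idx (p * q)%g) = (p == enum_val j * q^-1)%g.
    apply/eqP/eqP=> ->; first by rewrite gring_indexK ?inE // mulgK.
    by rewrite mulgKV gring_valK.
  over.
transitivity ((-1) ^+ odd_perm q * \sum_(p in row_stab n lam)
    (p == enum_val j * q^-1)%g%:R : algC); first by rewrite mulr_sumr.
congr (_ * _); rewrite -natr_sum; congr _%:R.
case: (boolP (enum_val j * q^-1 \in _)%g) => [Rp|nRp].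
  rewrite (bigD1 _ Rp) /= eqxx big1 // => p /andP[_ /negbTE->] //.
by rewrite big1 // => p Rp; case: eqP => // eq_p; rewrite -eq_p Rp in nRp.
Qed.

(* Left multiplication by the idempotent e, which commutes with the right     *)
(* regular representation and projects onto the Specht module.                *)
Definition young_proj : 'M[algC]_#|G| :=
  \matrix_(i, j) e (enum_val j * (enum_val i)^-1)%g.

Lemma young_projJ g : young_proj *m aG g = aG g *m young_proj.
Proof.
apply/matrixP=> i j; rewrite mulmx_regular regular_mulmx !mxE.
by rewrite !gring_indexK ?inE // invMg mulgA.
Qed.

(** By [trace_submod_repr], the character is the trace of x -> e x g on the whole group algebra. *)
Lemma Specht_charE g : Specht_char n lam g = \sum_h e (h * g^-1 * h^-1)%g.
Proof.
have v_proj : v *m young_proj = v.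
  apply/matrixP=> i j; rewrite {i}ord1 mxE young_symmetrizerE (reindex idx); last first.
    exact: onW_bij idx_bij.
  transitivity (conv e (young n lam) (enum_val j)).
    rewrite convEr; apply: eq_bigr => h _.
    by rewrite young_symmetrizerE mxE !gring_indexK ?inE // mulrC.
  by rewrite convZl conv_young // !scaleE mulKf // young_scale_neq0.
rewrite cfunE inE /Specht.
rewrite (@trace_submod_repr _ _ _ _ _ _ young_proj) ?inE //.
- rewrite /mxtrace (reindex idx) /=; last exact: onW_bij idx_bij.
  by apply: eq_bigr => h _; rewrite mulmx_regular mxE !gring_indexK ?inE.
(* The rows of the projection are multiples of translates of the symmetrizer. *)
- apply/row_subP=> i.
  have -> : row i young_proj = (young_scale n lam)^-1 *: (v *m aG (enum_val i)).
    apply/rowP=> j; rewrite mxE [young_proj _ _]mxE scaleE [RHS]mxE mulmx_regular.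
    by rewrite young_symmetrizerE gring_indexK ?inE.
  apply: scalemx_sub; apply: mxmodule_trans; rewrite ?inE ?cyclic_mx_id //.
  exact: cyclic_mx_module.
(* The vectors fixed by the projection form a submodule, as it commutes with the group, and this
   submodule contains the symmetrizer. *)
apply/eqP; rewrite -subr_eq0 -{2}[cyclic_mx _ _]mulmx1 -mulmxBr.
apply/eqP/sub_kermxP; apply: cyclic_mx_sub; last first.
  by apply/sub_kermxP; rewrite mulmxBr mulmx1 v_proj subrr.
apply: kermx_centg_module; apply/centgmxP=> g' _.
by rewrite mulmxBl mulmxBr mul1mx mulmx1 young_projJ.
Qed.

(** The character sums e over conjugates, which a class function F does not distinguish. *)
Lemma Specht_char_sum (V : lmodType algC) (F : 'S_n -> V) :
    (forall g h, F (g ^ h)%g = F g) ->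
  \sum_g Specht_char n lam g *: F g^-1%g = #|G|%:R *: \sum_g e g *: F g.
Proof.
move=> FJ; under eq_bigr do rewrite Specht_charE scaler_suml.
rewrite exchange_big /= cardsT scaler_nat -sumr_const; apply: eq_bigr => h _.
rewrite (reindex_inj invg_inj) (reindex_inj (@conjg_inj _ h)) /=.
by apply: eq_bigr => g _; rewrite !invgK FJ conjgE mulKVg mulgK.
Qed.

End SpechtCharacter.

Section SpechtOrthonormal.

Variables (n : nat).

Lemma Specht_char_dot lam mu (lam_part : is_partition lam) (sum_lam : sumn lam = n)
    (mu_part : is_partition mu) (sum_mu : sumn mu = n) :
  '[Specht_char n lam, Specht_char n mu]
    = \sum_h conv (young_idem n lam) (shift h (young_idem n mu)) h.
Proof.
rewrite cfdotE.
transitivity (#|[set: 'S_n]|%:R^-1 *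
    \sum_g Specht_char n lam g *: (Specht_char n mu g^-1%g : algC^o)).
  congr (_ * _); apply: eq_big => [g|g _]; first by rewrite inE.
  by rewrite char_inv ?cfRepr_char.
rewrite (Specht_char_sum lam_part sum_lam) => [|g h]; last by rewrite cfunJ ?inE.
transitivity (\sum_g young_idem n lam g * Specht_char n mu g).
  by apply: mulKf; rewrite pnatr_eq0 -lt0n cardG_gt0.
under [RHS]eq_bigr do rewrite convE.
rewrite [RHS]exchange_big; apply: eq_bigr => k _ /=.
rewrite -mulr_sumr; congr (_ * _); rewrite Specht_charE // (reindex_inj invg_inj) /=.
by apply: eq_bigr => h _; rewrite shiftE invgK mulgA.
Qed.

(** Write e h e = t_h e. The norm is the sum of t_h e(h), and expanding the middle factor of e = e e
    e shows that this sum times e is e; compare values at 1, where e is nonzero. *)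
Lemma Specht_char_norm lam (lam_part : is_partition lam) (sum_lam : sumn lam = n) :
  '[Specht_char n lam] = 1.
Proof.
rewrite Specht_char_dot //; set e := young_idem n lam.
have /fin_all_exists[t te] : forall h, exists t, conv e (shift h e) = scale t e.
  move=> h; have [t eq_t] := young_idem_conv lam_part sum_lam
    [ffun g => (g == h)%:R].
  by exists t; rewrite -eq_t shift_conv.
have e1_neq0 : e 1%g != 0.
  by rewrite scaleE young1 mulr1 invr_eq0 young_scale_neq0.
have eK : e = conv e (conv e e) by rewrite !young_idemK.
apply: (mulIf e1_neq0); rewrite mul1r [in RHS]eK conv_shift mulr_suml.
by apply: eq_bigr => h _; rewrite te ![scale (t h) _ _]scaleE mulrAC mulrC.
Qed.

(** The product is invariant under the rows of [mu] and satisfies the relations of [lam]. To be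
    nonzero it would need a semistandard tableau of shape [lam] and content [mu], which
    [semistandard_content] and [partition_eq] exclude. *)
Lemma young_idem_conv_eq0 lam mu (lam_part : is_partition lam) (sum_lam : sumn lam = n)
    (mu_part : is_partition mu) (sum_mu : sumn mu = n) x :
    (\sum_(i < n) cell_row mu i <= \sum_(i < n) cell_row lam i)%N -> lam != mu ->
  conv (young_idem n mu) (conv x (young_idem n lam)) = 0.
Proof.
move=> le_ml ne_lm.
have vanish := young_relations_vanish (sum_mu := sum_mu) lam_part sum_lam.
apply: vanish => [p g Rp||g /(semistandard_content lam_part sum_lam)/leqifP].
- apply: (@conv_row_stab _ mu) Rp => q k Rq.
  by rewrite scaleE [RHS]scaleE young_row.
- by do 2!apply: young_relations_conv; apply: young_relations_idem.
case: forallP => [eq_g _|_]; last by rewrite ltnNge le_ml.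
case/eqP: ne_lm; exact: (partition_eq lam_part sum_lam mu_part sum_mu (fun i => eqP (eq_g i))).
Qed.

Lemma Specht_char_ortho lam mu (lam_part : is_partition lam) (sum_lam : sumn lam = n)
    (mu_part : is_partition mu) (sum_mu : sumn mu = n) :
  '[Specht_char n lam, Specht_char n mu] = (lam == mu)%:R.
Proof.
case: eqP => [<-|/eqP]; first exact: Specht_char_norm.
wlog le_lm : lam mu lam_part sum_lam mu_part sum_mu /
    (\sum_(i < n) cell_row lam i <= \sum_(i < n) cell_row mu i)%N => [IH ne_lm|ne_lm].
  have [le_lm|/ltnW le_ml] := leqP (\sum_(i < n) cell_row lam i) (\sum_(i < n) cell_row mu i).
    exact: IH.
  by rewrite cfdotC IH // 1?eq_sym // conjC0.
rewrite Specht_char_dot // big1 // => h _.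
have -> : shift h (young_idem n mu) = conv [ffun g => (g == h)%:R] (young_idem n mu).
  exact: shift_conv.
by rewrite young_idem_conv_eq0 ?ffunE // eq_sym.
Qed.

End SpechtOrthonormal.
(** * Semistandard tableaux and the Kostka numbers *)

(** On each fibre of f, U and its rearrangement are sorted along g and have the same values with
    multiplicity, so they coincide. *)
Lemma sorted_rearrangement (n N : nat) (f g : 'I_n -> nat) (p : 'S_n)
    (U : {ffun 'I_n -> 'I_N}) :
    (forall i, f (p i) = f i) ->
    (forall i j, f i = f j -> (g i <= g j)%N -> (U i <= U j)%N) ->
    (forall i j, f i = f j -> (g i <= g j)%N -> (U (p i) <= U (p j))%N) ->
  word_act U p = U.
Proof.
move=> fp sortU sortT.
suffices card_le (T1 T2 : 'I_n -> 'I_N) (q : 'S_n) i : (forall k, f (q k) = f k) ->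
    (forall k, T1 k = T2 (q k)) ->
    (forall i j, f i = f j -> (g i <= g j)%N -> (T1 i <= T1 j)%N) ->
    (forall i j, f i = f j -> (g i <= g j)%N -> (T2 i <= T2 j)%N) ->
    (T1 i <= T2 i)%N.
  apply/ffunP=> i; rewrite ffunE; apply: val_inj; apply/eqP; rewrite eqn_leq.
  rewrite (card_le (fun i => U (p i)) U p) //= (card_le U (fun i => U (p i)) p^-1%g) // => k.
    by rewrite -[in RHS](permKV p k) fp.
  by rewrite permKV.
move=> fq T12 sort1 sort2; rewrite leqNgt; apply/negP=> lt_i.
(* Both sets count the values at most T2 i in the fibre of i, so they have equal size; yet if T2 i <
   T1 i the first is properly contained in the second. *)
pose A (T : 'I_n -> 'I_N) := [set k | (f k == f i) && (T k <= T2 i)%N].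
have eqA : #|A T1| = #|A T2|.
  rewrite -(card_imset _ (@perm_inj _ q)); apply: eq_card => k.
  apply/imsetP/idP=> [[l + ->]|Ak]; first by rewrite !inE fq T12.
  exists (q^-1 k)%g; last by rewrite permKV.
  move: Ak; rewrite !inE T12 permKV => /andP[/eqP <- ->].
  by rewrite -[in f k](permKV q k) fq eqxx.
have subA : A T1 \proper A T2.
  apply/properP; split; last by exists i; rewrite !inE eqxx ?leqnn // -ltnNge.
  apply/subsetP=> k; rewrite !inE => /andP[eq_f le_k]; rewrite eq_f /=.
  apply: sort2; first exact/eqP.
  rewrite leqNgt; apply/negP=> /ltnW/(sort1 _ _ (esym (eqP eq_f))).
  by rewrite leqNgt (leq_ltn_trans le_k).
by have := proper_card subA; rewrite eqA ltnn.
Qed.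

Section SemistandardIndependence.

Variables (n N : nat) (lam : seq nat).
Implicit Types (T U : {ffun 'I_n -> 'I_N}) (p q : 'S_n).

Lemma row_weight_row p U :
  p \in row_stab n lam -> row_weight lam (word_act U p) = row_weight lam U.
Proof.
move=> /row_stabP Rp; rewrite /row_weight [RHS](reindex_inj (@perm_inj _ p)) /=.
by apply: eq_bigr => i _; rewrite ffunE Rp.
Qed.

Lemma semistandard_sorted U : semistandard lam U ->
  (forall i j : 'I_n, cell_row lam i = cell_row lam j ->
     (cell_col lam i <= cell_col lam j)%N -> (U i <= U j)%N) /\
  (forall i j : 'I_n, cell_col lam i = cell_col lam j ->
     (cell_row lam i <= cell_row lam j)%N -> (U i <= U j)%N).
Proof.
case/semistandardP=> ssr ssc; split=> i j eq_ij; rewrite leq_eqVlt => /predU1P[eq'|].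
- by rewrite (cell_inj eq_ij eq').
- exact: ssr.
- by rewrite (cell_inj eq' eq_ij).
by move/(ssc _ _ eq_ij)/ltnW.
Qed.

Lemma semistandard_col_fixed q U :
  semistandard lam U -> q \in col_stab n lam -> word_act U q = U -> q = 1%g.
Proof.
move=> /semistandardP[_ ssc] /col_stabP Cq /ffunP Uq.
apply/permP=> i; rewrite perm1; apply: (cell_inj _ (Cq i)); apply/eqP.
have := Uq i; rewrite ffunE => /(congr1 val)/eqP; apply: contraLR.
by rewrite !neq_ltn => /orP[] /ssc -> //; rewrite ?orbT.
Qed.

(** A column rearrangement of maximal weight has sorted columns, hence is U itself; strictness of
    the columns makes the permutation trivial. *)
Lemma semistandard_max_weight q U : semistandard lam U -> q \in col_stab n lam ->
  (row_weight lam (word_act U q) <= row_weight lam U ?= iff (q == 1%g))%N.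
Proof.
move=> ssU Cq.
have max_fixed r : r \in col_stab n lam -> (forall q, q \in col_stab n lam ->
    (row_weight lam (word_act U q) <= row_weight lam (word_act U r))%N) -> r = 1%g.
  move=> Cr maxr; apply: (semistandard_col_fixed ssU Cr).
  apply: (sorted_rearrangement (f := cell_col lam) (g := cell_row lam)).
  - exact/col_stabP.
  - by have [] := semistandard_sorted ssU.
  move=> i j eq_c; rewrite leq_eqVlt => /predU1P[eq_r|lt_r].
    by rewrite (cell_inj eq_r eq_c).
  have := @sort_columns _ lam _ (word_act U r) _ i j eq_c lt_r.
  by rewrite !ffunE; apply=> s Cs; rewrite word_actM maxr ?groupM.
pose r := [arg max_(r > 1%g | r \in col_stab n lam) row_weight lam (word_act U r)].
have [Cr maxr] : r \in col_stab n lam /\ forall q', q' \in col_stab n lam ->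
    (row_weight lam (word_act U q') <= row_weight lam (word_act U r))%N.
  by rewrite /r; case: arg_maxnP => //; apply: group1.
have maxU s : s \in col_stab n lam -> (row_weight lam (word_act U s) <= row_weight lam U)%N.
  by move/maxr; rewrite [r]max_fixed // word_act1.
split; first exact: maxU.
apply/eqP/eqP=> [eq_w|->]; last by rewrite word_act1.
by apply: max_fixed => // s /maxU; rewrite eq_w.
Qed.

(* The coefficient of T in the image of the word U under the symmetrizer.     *)
Definition young_coef T U : algC := \sum_k young n lam k * (word_act U k == T)%:R.

Lemma young_coefE T U : young_coef T U =
  \sum_(p in row_stab n lam) \sum_(q in col_stab n lam)
     (-1) ^+ odd_perm q * (word_act (word_act U q) p == T)%:R.
Proof.
rewrite /young_coef; under eq_bigr do rewrite convE mulr_suml.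
rewrite exchange_big [RHS]big_mkcond; apply: eq_bigr => p _ /=.
case: ifP => Rp; last first.
  by rewrite big1 // => k _; rewrite ffunE Rp !mul0r.
rewrite (reindex_inj (mulgI p)) [RHS]big_mkcond; apply: eq_bigr => q _ /=.
rewrite !ffunE Rp mul1r mulKg -word_actM.
by case: ifP; rewrite ?mul1r ?mul0r.
Qed.

(** A contributing pair (p, q) gives T the weight of U moved by q, at most that of U. The hypothesis
    forces q = 1, and then T and U are row-sorted rearrangements of each other. On the diagonal the
    coefficient counts row permutations that fix T. *)
Lemma young_coef_triangular T U : semistandard lam T -> semistandard lam U ->
  (row_weight lam U <= row_weight lam T)%N -> (young_coef T U != 0) = (T == U).
Proof.
move=> ssT ssU le_UT.
have unique p q : p \in row_stab n lam -> q \in col_stab n lam ->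
    word_act (word_act U q) p = T -> q = 1%g /\ U = T.
  move=> Rp Cq eq_T; have maxU := semistandard_max_weight ssU Cq.
  have q1 : q = 1%g.
    apply/eqP; rewrite -maxU eqn_leq maxU /=.
    by rewrite -(row_weight_row (word_act U q) Rp) eq_T.
  split=> //; rewrite -eq_T q1 word_act1; apply/esym.
  have [sortT _] := semistandard_sorted ssT.
  apply: (sorted_rearrangement (f := cell_row lam) (g := cell_col lam)).
  - exact/row_stabP.
  - by have [] := semistandard_sorted ssU.
  by move=> i j eq_r le_c; have := sortT i j eq_r le_c; rewrite -eq_T q1 word_act1 !ffunE.
rewrite young_coefE; case: (T =P U) => [eq_TU|ne_TU]; last first.
  rewrite big1 ?eqxx // => p Rp; rewrite big1 // => q Cq.
  by case: eqP => [/(unique _ _ Rp Cq)[_ /esym]//|]; rewrite mulr0.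
rewrite (eq_bigr (fun p => (word_act U p == T)%:R)) => [|p Rp].
  rewrite -natr_sum pnatr_eq0 -lt0n (bigD1 1%g) ?group1 //= word_act1 eq_TU eqxx //.
rewrite (bigD1 1%g) ?group1 //= word_act1 odd_perm1 mul1r big1 ?addr0 // => q /andP[Cq ne_q].
by case: eqP => [/(unique _ _ Rp Cq)[/eqP]|]; rewrite ?mulr0 // (negbTE ne_q).
Qed.

End SemistandardIndependence.
Section WordContent.

Variables (n N : nat).
Implicit Types w : {ffun 'I_n -> 'I_N}.

Definition word_content w : 'X_{1..N} := (\sum_i U_(w i))%MM.

Lemma word_content_act w g : word_content (word_act w g) = word_content w.
Proof.
rewrite /word_content [RHS](reindex_inj (@perm_inj _ g)) /=.
by apply: eq_bigr => i _; rewrite ffunE.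
Qed.

Lemma prod_mpolyX (I : Type) (r : seq I) (P : pred I) (F : I -> 'X_{1..N}) :
  \prod_(i <- r | P i) 'X_[F i] = 'X_[(\sum_(i <- r | P i) F i)%MM] :> {mpoly algC[N]}.
Proof. by rewrite (big_morph _ (@mpolyXD _ _) (@mpolyX0 _ _)). Qed.

Lemma mcoeff_word_sum (P : pred {ffun 'I_n -> 'I_N}) m :
  (\sum_(w | P w) 'X_[word_content w] : {mpoly algC[N]})@_m
    = (\sum_(w | P w) (word_content w == m))%:R.
Proof.
rewrite linear_sum /= natr_sum; apply: eq_bigr => w _.
by rewrite mcoeffX.
Qed.

End WordContent.

(* The symmetrizer acts on the words of content m by the idempotent E.  Its   *)
(* rank, hence its trace, is the number of semistandard tableaux of content m:*)
(* straightening bounds it from above, and triangularity from below.          *)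
Section Kostka.

Variables (n : nat) (lam : seq nat).
Hypotheses (lam_part : is_partition lam) (sum_lam : sumn lam = n).
Variables (N : nat) (m : 'X_{1..N}).

Local Notation word := {ffun 'I_n -> 'I_N}.
Local Notation e := (young_idem n lam).

Let S : {set word} := [set T | semistandard lam T & word_content T == m].

Let E : 'M[algC]_#|word| := \matrix_(i, j)
  if word_content (enum_val i) == m
  then \sum_k e k * (word_act (enum_val j) k == enum_val i)%:R else 0.

Lemma mul_kostka_mx r (A : 'M[algC]_(r, #|word|)) i (w : word) :
  (A *m E) i (enum_rank w) =
    if word_content w == m then \sum_k e k * A i (enum_rank (word_act w k)) else 0.
Proof.
rewrite mxE; under eq_bigr do rewrite mxE enum_rankK.
case: ifP => cw; last first.
  rewrite big1 // => x _; case: ifP => cx; last by rewrite mulr0.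
  rewrite big1 ?mulr0 // => k _; case: eqP => [eq_x|]; last by rewrite mulr0.
  by rewrite -eq_x word_content_act cw in cx.
transitivity (\sum_j \sum_k e k * (A i j * (word_act w k == enum_val j)%:R)).
  apply: eq_bigr => j _; case: ifP => cj.
    by rewrite mulr_sumr; apply: eq_bigr => k _; rewrite mulrCA.
  rewrite mulr0 big1 // => k _; case: eqP => [eq_j|]; last by rewrite !mulr0.
  by rewrite -eq_j word_content_act cw in cj.
rewrite exchange_big; apply: eq_bigr => k _ /=.
rewrite -mulr_sumr (bigD1 (enum_rank (word_act w k))) //= enum_rankK eqxx mulr1.
rewrite big1 ?addr0 // => j ne_j; case: eqP => [eq_j|]; last by rewrite mulr0.
by rewrite eq_j enum_valK eqxx in ne_j.
Qed.

Lemma kostka_mx_idem : E *m E = E.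
Proof.
apply/matrixP=> i j; rewrite -[j]enum_valK mul_kostka_mx mxE enum_rankK.
set w := enum_val j; case: (_ =P m) => [cw|/eqP cw]; last first.
  case: ifP => // ci; rewrite big1 // => k _; case: eqP => [eq_i|]; last by rewrite mulr0.
  by rewrite -eq_i word_content_act (negbTE cw) in ci.
under eq_bigr do rewrite mxE enum_rankK.
case: ifP => ci; last by rewrite big1 // => k _; rewrite mulr0.
rewrite -[in RHS](young_idemK lam_part sum_lam).
under [RHS]eq_bigr do rewrite convEr mulr_suml.
under eq_bigr do rewrite mulr_sumr.
rewrite [RHS]exchange_big /=; apply: eq_bigr => k _ /=.
rewrite [RHS](reindex_inj (mulIg k)) /=; apply: eq_bigr => l _.
by rewrite mulgK word_actM mulrCA mulrA.
Qed.

(** Right multiplication by [sel] keeps the columns indexed by [S]. *)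
Let sel : 'M[algC]_(#|word|, #|S|) := \matrix_(i, j) (i == enum_rank (enum_val j))%:R.

Lemma mul_sel r (A : 'M[algC]_(r, #|word|)) i j :
  (A *m sel) i j = A i (enum_rank (enum_val j)).
Proof.
rewrite mxE (bigD1 (enum_rank (enum_val j))) //= mxE eqxx mulr1 big1 ?addr0 // => k.
by rewrite mxE => /negbTE->; rewrite mulr0.
Qed.

(** The entries of x E, as a function of the word, satisfy the hypotheses of [straightening]. Thus E
    and its columns in [S] have the same left kernel, which bounds the rank of E by #|S|. *)
Lemma kostka_mx_vanish (x : 'rV[algC]_#|word|) : x *m (E *m sel) = 0 -> x *m E = 0.
Proof.
move=> x0; pose f w := (x *m E) 0 (enum_rank w).
have fE w k : word_content w = m -> f (word_act w k) =
    \sum_h e (h * k^-1)%g * x 0 (enum_rank (word_act w h)).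
  move=> cw; rewrite /f mul_kostka_mx word_content_act cw eqxx (reindex_inj (mulIg k^-1)%g).
  by apply: eq_bigr => h _; rewrite word_actM mulgKV.
have f0 w k : word_content w != m -> f (word_act w k) = 0.
  by move=> cw; rewrite /f mul_kostka_mx word_content_act (negbTE cw).
have [eC eG] := young_relations_idem n lam.
suffices fz w : f w = 0 by apply/rowP=> i; rewrite [RHS]mxE -[i]enum_valK; apply: fz.
apply: (straightening lam_part sum_lam) w => [q w Cq|Z w gZ|T ssT].
- have [cw|cw] := eqVneq (word_content w) m; last first.
    by rewrite f0 // -[w]word_act1 f0 // mulr0.
  rewrite fE // -[in RHS](word_act1 w) fE // mulr_sumr.
  by apply: eq_bigr => h _; rewrite invg1 mulg1 eC // mulrA.
- have [cw|cw] := eqVneq (word_content w) m; last first.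
    by rewrite big1 // => k _; rewrite f0 // mulr0.
  under eq_bigr do rewrite fE // mulr_sumr.
  rewrite exchange_big big1 //= => h _.
  under eq_bigr do rewrite mulrA.
  by rewrite -mulr_suml eG // mul0r.
have [cT|cT] := eqVneq (word_content T) m; last by rewrite -[T]word_act1 f0.
have ST : T \in S by rewrite inE ssT cT eqxx.
move/rowP/(_ (enum_rank_in ST T)): x0.
by rewrite mulmxA mul_sel enum_rankK_in // [RHS]mxE.
Qed.

(** The block of E on [S] is the matrix of [young_coef] up to a nonzero scalar. For u in its left
    kernel, take j of least [row_weight] in the support: by triangularity coordinate j of the
    product is u_j times a nonzero diagonal entry. *)
Lemma kostka_mx_free : row_free (sel^T *m (E *m sel)).
Proof.
rewrite -kermx_eq0; apply/eqP/row_matrixP=> r; rewrite row0.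
set u := row r _; have /sub_kermxP u0 : (u <= kermx (sel^T *m (E *m sel)))%MS.
  exact: row_sub.
have EE i j : (sel^T *m (E *m sel)) i j
    = (young_scale n lam)^-1 * young_coef lam (enum_val i) (enum_val j).
  rewrite mxE (bigD1 (enum_rank (enum_val i))) //= big1 => [|k]; last first.
    by rewrite !mxE => /negbTE->; rewrite mul0r.
  rewrite addr0 [sel^T _ _]mxE [sel _ _]mxE eqxx mul1r mul_sel mxE !enum_rankK.
  have := enum_valP i; rewrite inE => /andP[_ ->].
  rewrite mulr_sumr; apply: eq_bigr => k _.
  by rewrite scaleE mulrA.
apply/rowP=> j0; rewrite [RHS]mxE; apply/eqP/negPn/negP=> nz_j0.
pose j := [arg min_(j < j0 | u 0 j != 0) row_weight lam (enum_val j : word)].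
have [nz_j min_j] : u 0 j != 0 /\ forall i, u 0 i != 0 ->
    (row_weight lam (enum_val j : word) <= row_weight lam (enum_val i : word))%N.
  by rewrite /j; case: arg_minnP.
have ssE (i : 'I_#|S|) : semistandard lam (enum_val i : word).
  by have := enum_valP i; rewrite inE => /andP[-> _].
have := congr1 (fun x : 'rV_#|S| => x 0 j) u0.
rewrite !mxE (bigD1 j) //= big1 ?addr0 => [|i ne_ij].
  move/eqP; rewrite EE !mulf_eq0 (negbTE nz_j) invr_eq0.
  rewrite (negbTE (young_scale_neq0 lam_part sum_lam)) /= -[_ == 0]negbK.
  by rewrite young_coef_triangular // eqxx.
rewrite EE; have [->|/min_j le_ji] := eqVneq (u 0 i) 0; first by rewrite mul0r.
have := young_coef_triangular (ssE i) (ssE j) le_ji.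
rewrite (inj_eq enum_val_inj) (negbTE ne_ij) => /negbFE/eqP->.
by rewrite !mulr0.
Qed.

Lemma kostka_number : \sum_k e k *
    (\sum_(w : word | word_act w k == w) (word_content w == m))%:R = #|S|%:R.
Proof.
transitivity (\tr E).
  rewrite /mxtrace (reindex enum_rank) /=; last exact: onW_bij (enum_rank_bij _).
  under [RHS]eq_bigr do rewrite mxE enum_rankK -mulrb -mulr_natr big_distrl /=.
  rewrite [RHS]exchange_big /=; apply: eq_bigr => k _.
  rewrite natr_sum mulr_sumr big_mkcond; apply: eq_bigr => w _ /=.
  by case: eqP => _; case: eqP => _; rewrite ?mulr0 ?mulr1.
rewrite trace_idempotent; last exact: kostka_mx_idem.
congr _%:R; apply/eqP; rewrite eqn_leq; apply/andP; split.
  apply: leq_trans (rank_leq_col (E *m sel)).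
  have := mxrank_ker E; have := mxrank_ker (E *m sel).
  have : (\rank (kermx (E *m sel)) <= \rank (kermx E))%N.
    apply/mxrankS/row_subP=> i; apply/sub_kermxP/kostka_mx_vanish.
    exact/sub_kermxP/row_sub.
  have := rank_leq_row E; have := rank_leq_row (E *m sel); lia.
have /eqP <- := kostka_mx_free.
by rewrite (leq_trans (mxrankM_maxr _ _)) // mxrankM_maxl.
Qed.

End Kostka.

Lemma schurE n lam (lam_part : is_partition lam) (sum_lam : sumn lam = n) N :
  schur lam N = \sum_k young_idem n lam k *:
     \sum_(w : {ffun 'I_n -> 'I_N} | word_act w k == w) 'X_[word_content w].
Proof.
apply/mpolyP=> m; rewrite [RHS]linear_sum /=.
under [RHS]eq_bigr do rewrite mcoeffZ mcoeff_word_sum.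
rewrite kostka_number //; case: n / sum_lam => /=.
rewrite /schur; under eq_bigr do rewrite prod_mpolyX -/(word_content _).
rewrite mcoeff_word_sum -sum1_card [in RHS]big_mkcond /=; congr _%:R; rewrite big_mkcond /=.
apply: eq_bigr => T _; rewrite inE (_ : semistandard lam T = is_ssyt T) //.
by case: is_ssyt; case: eqP.
Qed.
(** * The Frobenius characteristic *)

Section CycleType.

Variable T : finType.
Implicit Types (s t : {perm T}) (A O : {set T}).

Definition sorted_porbits s : seq {set T} :=
  sort (fun A O : {set T} => #|O| <= #|A|)%N (enum (porbits s)).
Definition cycle_type s : seq nat := map (fun O : {set T} => #|O|) (sorted_porbits s).

Lemma mem_sorted_porbits s O : (O \in sorted_porbits s) = (O \in porbits s).
Proof. by rewrite mem_sort mem_enum. Qed.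

Lemma sumn_cycle_type s : sumn (cycle_type s) = #|T|.
Proof.
have part : partition (porbits s) [set: T].
  apply/and3P; split.
  - rewrite eqEsubset subsetT; apply/subsetP=> x _.
    by apply/bigcupP; exists (porbit s x); rewrite ?porbit_id // imset_f.
  - apply/trivIsetP=> _ _ /imsetP[x _ ->] /imsetP[y _ ->]; apply: contraR.
    case/pred0Pn=> z /andP[/= xz yz].
    rewrite -eq_porbit_mem in xz; rewrite -eq_porbit_mem in yz.
    by rewrite -(eqP xz) -(eqP yz).
  apply/negP=> /imsetP[x _ x0]; have := porbit_id s x.
  by rewrite -x0 inE.
rewrite -cardsT (card_partition part) sumnE big_map.
by rewrite (perm_big (enum (porbits s))) ?perm_sort // big_enum.
Qed.

Lemma partition_cycle_type s : is_partition (cycle_type s).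
Proof.
apply/andP; split.
  rewrite /cycle_type sorted_map; apply: sort_sorted => A B.
  by rewrite /= leq_total.
apply/mapP=> -[O]; rewrite mem_sorted_porbits => /imsetP[x _ ->] /esym/eqP.
by rewrite (negbTE (card_porbit_neq0 s x)).
Qed.

(** Match the orbits of s and t by their positions in the sorted lists, choose base points b and c
    in matched orbits, and send s^k b to t^k c. *)
Lemma cycle_type_conj s t : cycle_type s = cycle_type t -> exists u, t = (s ^ u)%g.
Proof.
move=> eq_st.
have sizeE r : size (sorted_porbits r) = size (cycle_type r) by rewrite size_map.
pose g x := nth set0 (sorted_porbits t) (index (porbit s x) (sorted_porbits s)).
have inO r x : porbit r x \in sorted_porbits r by rewrite mem_sorted_porbits imset_f.
have lt_idx x : (index (porbit s x) (sorted_porbits s) < size (sorted_porbits t))%N.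
  by rewrite sizeE -eq_st -sizeE index_mem.
have uniqO r : uniq (sorted_porbits r) by rewrite sort_uniq enum_uniq.
have gt x : g x \in porbits t by rewrite -mem_sorted_porbits mem_nth.
have card_g x : #|g x| = #|porbit s x|.
  rewrite -(nth_map set0 0%N (fun O : {set T} => #|O|)) // -/(cycle_type t) -eq_st.
  by rewrite (nth_map set0) ?index_mem // nth_index.
have g_inj x y : g x = g y -> porbit s x = porbit s y.
  move/eqP; rewrite nth_uniq // => /eqP.
  by move=> eq_i; rewrite -(nth_index set0 (inO s x)) eq_i nth_index.
pose rep x A := odflt x [pick y in A].
have repP x r A : A \in porbits r -> porbit r (rep x A) = A.
  case/imsetP=> y _ ->; rewrite /rep; case: pickP => [z|/(_ y)]; last by rewrite porbit_id.
  by rewrite -eq_porbit_mem => /eqP.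
have rep_cst x y r A : A \in porbits r -> rep x A = rep y A.
  case/imsetP=> z _ ->; rewrite /rep; case: pickP => [//|/(_ z)].
  by rewrite porbit_id.
(* In [rep] the point x is a default for empty sets only, so b and c are constant on orbits of s
   ([rep_cst]). *)
pose b x := rep x (porbit s x); pose c x := rep x (g x).
have ps x : porbit s (s x) = porbit s x by exact: (porbit_perm s 1 x).
have bs x : b (s x) = b x.
  by rewrite /b ps; apply: (rep_cst _ _ s); apply: imset_f.
have gs x : g (s x) = g x by rewrite /g ps.
have cs x : c (s x) = c x by rewrite /c gs; apply: (rep_cst _ _ t).
have pb x : porbit s (b x) = porbit s x by apply: repP; apply: imset_f.
have pc x : porbit t (c x) = g x by apply: repP.
pose k x := index x (traject s (b x) #|porbit s x|).
have in_tr x : x \in traject s (b x) #|porbit s x|.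
  by rewrite -pb -porbit_traject pb porbit_id.
have kP x : iter (k x) s (b x) = x.
  have lt_k := in_tr x; rewrite -index_mem size_traject in lt_k.
  by rewrite -[RHS](nth_index (b x) (in_tr x)) nth_traject.
have k_lt x : (k x < #|porbit s x|)%N.
  by have := in_tr x; rewrite -index_mem size_traject.
pose u x := iter (k x) t (c x).
have us x : u (s x) = t (u x).
  have uniq_tr : uniq (traject s (b x) #|porbit s x|).
    by rewrite -pb uniq_traject_porbit.
  (* Either s x is the next point of the traject, or it closes the cycle at the base point; matched
     orbits have equal length, so t closes up too. *)
  rewrite /u cs /k bs ps -/(k x); have := k_lt x; rewrite leq_eqVlt => /predU1P[eq_k|lt_k].
    have -> : s x = nth (b x) (traject s (b x) #|porbit s x|) 0.
      rewrite nth_traject ?(leq_ltn_trans _ (k_lt x)) //=.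
      by rewrite -{1}(kP x) -iterS eq_k -pb iter_porbit.
    rewrite index_uniq // ?size_traject ?(leq_ltn_trans _ (k_lt x)) //=.
    by rewrite -iterS eq_k -card_g -pc iter_porbit.
  have -> : s x = nth (b x) (traject s (b x) #|porbit s x|) (k x).+1.
    by rewrite nth_traject //= kP.
  by rewrite index_uniq // size_traject.
have u_inj : injective u.
  move=> x y eq_u.
  have pu z : porbit t (u z) = g z.
    by rewrite /u -permX porbit_perm pc.
  have eq_g : g x = g y by rewrite -!pu eq_u.
  have eq_p := g_inj _ _ eq_g.
  have eq_c : c x = c y by rewrite /c eq_g; apply: (rep_cst _ _ t).
  have eq_b : b x = b y by rewrite /b eq_p; apply: (rep_cst _ _ s); apply: imset_f.
  have lt_x := k_lt x; have lt_y := k_lt y.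
  rewrite -eq_p -card_g -pc in lt_y; rewrite -card_g -pc in lt_x.
  rewrite -(kP x) -(kP y) eq_b; congr (iter _ s (b y)).
  have size_tr : size (traject t (c x) #|porbit t (c x)|) = #|porbit t (c x)|.
    exact: size_traject.
  apply/eqP; rewrite -(nth_uniq (c x) _ _ (uniq_traject_porbit t (c x))) ?size_tr //.
  by rewrite !nth_traject // -/(u x) eq_c -/(u y) eq_u.
exists (perm u_inj); apply/permP=> z.
have [x ->] : exists x, z = perm u_inj x by exists ((perm u_inj)^-1%g z); rewrite permKV.
by rewrite -[RHS]permM -conjgC permM !permE us.
Qed.

End CycleType.

Section FrobeniusCharacteristic.

Variable n : nat.

Definition partitions_of : {set n.-bseq 'I_n.+1} :=
  [set l : n.-bseq 'I_n.+1 | is_partition (map val l) && (sumn (map val l) == n)].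

Lemma card_classes_partitions : (#|classes [set: 'S_n]| <= #|partitions_of|)%N.
Proof.
have bound (s : 'S_n) i : i \in cycle_type s -> (i < n.+1)%N.
  move=> si; rewrite ltnS -[leqRHS]card_ord -(sumn_cycle_type s) sumnE.
  by rewrite (big_rem i) //= leq_addr.
have size_le (s : 'S_n) : (size (map (@inord n) (cycle_type s)) <= n)%N.
  rewrite size_map -[leqRHS]card_ord -(sumn_cycle_type s).
  have /andP[_] := partition_cycle_type s; elim: (cycle_type s) => //= i l IHl.
  by rewrite inE negb_or eq_sym -lt0n => /andP[i_gt0 /IHl]; lia.
pose f (A : {set 'S_n}) : n.-bseq 'I_n.+1 := Bseq (size_le (repr A)).
have fE A : map val (f A) = cycle_type (repr A).
  rewrite /= -map_comp map_id_in // => i /bound lt_i.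
  by rewrite /= inordK.
have f_inj : {in classes [set: 'S_n] &, injective f}.
  move=> A B clA clB /(congr1 (fun l : n.-bseq _ => map val l)).
  rewrite !fE => /cycle_type_conj[u eq_u].
  have [_ ->] := repr_classesP clA; have [_ ->] := repr_classesP clB.
  by rewrite eq_u classGidl ?inE.
rewrite -(card_in_imset f_inj); apply/subset_leq_card/subsetP=> _ /imsetP[A _ ->].
by rewrite inE fE partition_cycle_type sumn_cycle_type card_ord /=.
Qed.

(* The Specht characters are distinct and irreducible, and there are at least *)
(* as many of them as conjugacy classes.                                      *)
Lemma Specht_char_sum_dot (phi : 'CF([set: 'S_n])) :
  phi = \sum_(l in partitions_of)
    '[phi, Specht_char n (map val l)] *: Specht_char n (map val l).
Proof.
pose h (l : n.-bseq 'I_n.+1) := cfIirr (Specht_char n (map val l)).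
have hE l : l \in partitions_of -> 'chi_(h l) = Specht_char n (map val l).
  rewrite inE => /andP[part /eqP sum]; apply: cfIirrE.
  by rewrite irrEchar cfRepr_char Specht_char_norm // eqxx.
have h_inj : {in partitions_of &, injective h}.
  move=> l1 l2 Pl1 Pl2 /(congr1 (fun i => 'chi_i)); rewrite !hE // => eq_chi.
  move: Pl1 Pl2; rewrite !inE => /andP[part1 /eqP sum1] /andP[part2 /eqP sum2].
  have := Specht_char_ortho part1 sum1 part2 sum2.
  rewrite eq_chi Specht_char_norm //; case: eqP => [/(inj_map val_inj)/val_inj//|_].
  by move/eqP; rewrite oner_eq0.
have h_onto : h @: partitions_of = setT.
  apply/eqP; rewrite eqEcard subsetT cardsT card_ord (card_in_imset h_inj).
  by rewrite NirrE card_classes_partitions.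
rewrite {1}[phi]cfun_sum_cfdot.
transitivity (\sum_(i in h @: partitions_of) '[phi, 'chi_i] *: 'chi_i).
  by rewrite h_onto; apply: eq_bigl => i; rewrite inE.
by rewrite big_imset //=; apply: eq_bigr => l Pl; rewrite hE.
Qed.

(* The power sum symmetric function of the cycle type of g, in N variables.   *)
Definition fixed_words N (g : 'S_n) : {mpoly algC[N]} :=
  \sum_(w : {ffun 'I_n -> 'I_N} | word_act w g == w) 'X_[word_content w].

Lemma fixed_wordsJ N g h : fixed_words N (g ^ h)%g = fixed_words N g.
Proof.
rewrite /fixed_words (reindex_inj (@word_act_inj _ _ h^-1%g)) /=.
apply: eq_big => [w|w _]; last by rewrite word_content_act.
by rewrite word_actM conjgE mulgA mulgK -word_actM (inj_eq (@word_act_inj _ _ _)).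
Qed.

Lemma fixed_wordsV N g : fixed_words N g^-1%g = fixed_words N g.
Proof.
apply: eq_bigl => w; rewrite -(inj_eq (@word_act_inj _ _ g)).
by rewrite word_actKV eq_sym.
Qed.

Lemma schur_fixed_words N lam (lam_part : is_partition lam) (sum_lam : sumn lam = n) :
  schur lam N = #|[set: 'S_n]|%:R^-1 *:
     \sum_g Specht_char n lam g *: fixed_words N g.
Proof.
rewrite (schurE lam_part sum_lam).
under [in RHS]eq_bigr do rewrite -fixed_wordsV.
rewrite Specht_char_sum // => [|g h]; last exact: fixed_wordsJ.
by rewrite scalerA mulVf ?scale1r // pnatr_eq0 -lt0n cardG_gt0.
Qed.

(** Expand phi in the orthonormal basis of Specht characters and use [schur_fixed_words]
    termwise. *)
Lemma Ch_fixed_words N (phi : 'CF([set: 'S_n])) :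
  Ch phi N = #|[set: 'S_n]|%:R^-1 *: \sum_g phi g *: fixed_words N g.
Proof.
under [in RHS]eq_bigr do rewrite {1}[phi]Specht_char_sum_dot sum_cfunE scaler_suml.
rewrite exchange_big scaler_sumr /=; apply: eq_big => [l|l Pl]; first by rewrite inE.
have /andP[part /eqP sum] := Pl.
rewrite (schur_fixed_words N part sum) scalerA mulrC -scalerA; congr (_ *: _).
by rewrite scaler_sumr; apply: eq_bigr => g _; rewrite scalerA; congr (_ *: _); rewrite [RHS]cfunE.
Qed.

End FrobeniusCharacteristic.

(** * Plethysm of Schur functions with sums of monomials *)

Section Plethysm.

Variables (n : nat) (lam : seq nat) (N : nat).
Hypotheses (lam_part : is_partition lam) (sum_lam : sumn lam = n).

Lemma plethysm_schur (g : seq 'X_{1..N}) :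
  plethysm (schur lam) g = #|[set: 'S_n]|%:R^-1 *:
    \sum_k Specht_char n lam k *:
      \sum_(w : {ffun 'I_n -> 'I_(size g)} | word_act w k == w)
         \prod_(i < n) 'X_[tnth (in_tuple g) (w i)].
Proof.
rewrite /plethysm (schur_fixed_words _ lam_part sum_lam).
set lq := [tuple _ | i < _]; have sumE := big_morph _ (comp_mpolyD lq) (comp_mpoly0 lq).
rewrite comp_mpolyZ sumE; congr (_ *: _); apply: eq_bigr => k _.
rewrite comp_mpolyZ sumE; congr (_ *: _); apply: eq_bigr => w _.
rewrite /word_content -prod_mpolyX rmorph_prod; apply: eq_bigr => i _ /=.
by rewrite comp_mpolyXU -tnth_nth tnth_mktuple.
Qed.

(** The variables are the positions of a list that enumerates A, so a word in them is a function
    into A. *)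
Lemma plethysm_schur_enum (K : finType) (A : {set K}) (F : K -> 'X_{1..N}) :
  plethysm (schur lam) [seq F x | x <- enum A] = #|[set: 'S_n]|%:R^-1 *:
    \sum_(k : 'S_n) Specht_char n lam k *:
      \sum_(f : {ffun 'I_n -> K} | [forall i, (f i \in A) && (f (k i) == f i)])
         \prod_(i < n) 'X_[F (f i)].
Proof.
rewrite plethysm_schur; congr (_ *: _); apply: eq_bigr => k _; congr (_ *: _).
set g := [seq F x | x <- enum A].
have size_g : size g = #|A| by rewrite size_map -cardE.
pose h (j : 'I_(size g)) : K := enum_val (cast_ord size_g j).
have hA j : h j \in A := enum_valP _.
have h_inj : injective h by move=> j l /enum_val_inj/cast_ord_inj.
have hF j : tnth (in_tuple g) j = F (h j).
  have lt_j : (j < size (enum A))%N by rewrite -cardE -size_g.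
  rewrite (tnth_nth 0%MM) /= (nth_map (h j)) //; congr F.
  by rewrite [RHS](enum_val_nth (h j)).
pose H (w : {ffun 'I_n -> 'I_(size g)}) := [ffun i => h (w i)].
have H_inj : injective H.
  move=> w v /ffunP eq_wv; apply/ffunP=> i; apply: h_inj.
  by have := eq_wv i; rewrite !ffunE.
transitivity (\sum_(f in H @: [set w | word_act w k == w]) \prod_(i < n) 'X_[F (f i)]
   : {mpoly algC[N]}).
  rewrite big_imset /=; last by move=> w v _ _; apply: H_inj.
  apply: eq_big => [w|w _]; first by rewrite inE.
  by apply: eq_bigr => i _; rewrite ffunE hF.
apply: eq_bigl => f; apply/imsetP/forallP=> [[w + ->] i|Af].
  rewrite inE => /eqP/ffunP/(_ i); rewrite !ffunE hA => ->.
  by rewrite eqxx.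
have fA i : f i \in A by case/andP: (Af i).
exists [ffun i => cast_ord (esym size_g) (enum_rank_in (fA i) (f i))].
  rewrite inE; apply/eqP/ffunP=> i; rewrite !ffunE.
  apply: h_inj; rewrite /h !cast_ordKV !enum_rankK_in //.
  by have /andP[_ /eqP] := Af i.
by apply/ffunP=> i; rewrite !ffunE /h cast_ordKV enum_rankK_in.
Qed.

End Plethysm.

(** * Induced characters and the wreath product *)

(** Frobenius reciprocity with a class function valued in a vector space, here polynomials. *)
Lemma sum_cfInd (gT : finGroupType) (G H : {group gT}) (phi : 'CF(H))
    (V : lmodType algC) (F : gT -> V) :
    H \subset G -> {in G &, forall g h, F (g ^ h)%g = F g} ->
  #|G|%:R^-1 *: \sum_(g in G) 'Ind[G, H] phi g *: F g
    = #|H|%:R^-1 *: \sum_(h in H) phi h *: F h.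
Proof.
move=> sHG FJ; under eq_bigr do rewrite cfIndE // -scalerA scaler_suml.
rewrite -scaler_sumr exchange_big /=.
rewrite (eq_bigr (fun=> \sum_(h in H) phi h *: F h)) => [|y Gy].
  rewrite sumr_const -scaler_nat !scalerA mulrCA mulVf ?mulr1 //.
  by rewrite pnatr_eq0 -lt0n cardG_gt0.
rewrite (reindex_inj (@conjg_inj _ y^-1%g)) /=.
rewrite (eq_bigl (mem G)) => [|g]; last by rewrite /= memJ_norm // groupV (subsetP (normG G)).
rewrite [RHS]big_mkcond [LHS]big_mkcond /=; apply: eq_bigr => g _.
case: ifP => Gg; last by case: ifP => // /(subsetP sHG); rewrite Gg.
rewrite conjgKV FJ ?groupV //.
by case: ifP => // nHg; rewrite cfun0 ?nHg // scale0r.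
Qed.

Section WreathCharacter.

Variables (a : nat) (omega : algC).
Hypothesis prim_omega : a.-primitive_root omega.

(** The tensor power of a one-dimensional module is one-dimensional, so its trace is a product of
    scalars. *)
Lemma trace_wreath_repr (r m : nat) (lam : seq nat) (y : wreath 'S_a m) :
  \tr (wreath_repr (chi_repr prim_omega r) (Specht m lam) y)
    = (\prod_(i < m) omega ^+ (r * rotation_log (wbase y i))) * Specht_char m lam (wperm y).
Proof.
rewrite /wreath_repr /= mxtrace_prod; congr (_ * _); last by rewrite cfunE inE mulr1n.
rewrite /mxtrace (eq_bigr (fun=> \prod_(i < m) omega ^+ (r * rotation_log (wbase y i)))).
  by rewrite sumr_const card_ord card_ffun !card_ord exp1n mulr1n.
move=> p _; rewrite mxE; apply: eq_bigr => i _.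
by rewrite !ord1 mxE eqxx mulr1n.
Qed.

Variables (b : nat) (lam : 'I_a -> seq nat).
Hypothesis sum_lam : (\sum_(r < a) sumn (lam r))%N = b.
Hypothesis a_gt0 : (0 < a)%N.

(** On [wrY], the character that [Specht_wreath] induces. *)
Definition block_character (x : wreath 'S_a b) : algC :=
  \prod_(r < a) ((\prod_(j < sumn (lam r))
     omega ^+ (r.+1 * rotation_log (wbase x (block_elt sum_lam j))))
   * Specht_char (sumn (lam r)) (lam r) (perm_block sum_lam r (wperm x))).

Lemma Ch_Ind_Specht_wreath N :
  Ch ('Ind[[set: 'S_(a * b)], wreath_image a b]
        (cfIsom (wreath_perm_isom b a_gt0) (Specht_wreath prim_omega sum_lam))) N
  = #|wrY (Cyc a) sum_lam|%:R^-1 *: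
      \sum_(x in wrY (Cyc a) sum_lam)
         block_character x *: fixed_words N (wreath_perm x).
Proof.
rewrite Ch_fixed_words.
transitivity (#|[set: 'S_(a * b)]|%:R^-1 *: \sum_(g in [set: 'S_(a * b)])
  'Ind[[set: 'S_(a * b)], wreath_image a b]
        (cfIsom (wreath_perm_isom b a_gt0) (Specht_wreath prim_omega sum_lam)) g
     *: fixed_words N g).
  by congr (_ *: _); apply: eq_bigl => g; rewrite inE.
rewrite sum_cfInd ?subsetT // => [|g h _ _]; last exact: fixed_wordsJ.
have inj_wr : {in wr (Cyc a) b &, injective (@wreath_perm a b)}.
  exact: in2W (wreath_perm_inj a_gt0).
set psi := cfIsom _ _; pose f h := psi h.
have imE : @wreath_perm a b @: wr (Cyc a) b = wreath_image a b by rewrite /= morphimEdom.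
transitivity (#|@wreath_perm a b @: wr (Cyc a) b|%:R^-1 *:
  \sum_(h in @wreath_perm a b @: wr (Cyc a) b) f h *: fixed_words N h); first by rewrite imE.
rewrite card_in_imset // big_imset //=.
under eq_bigr => x Gx do rewrite /f /psi cfIsomE //.
rewrite (sum_cfInd (G := wr_group (Cyc a) b) (H := wrY_group (Cyc a) sum_lam) _
   (F := fun x => fixed_words N (wreath_perm x))) ?wrY_wr //; last first.
  move=> g h Gg Gh /=; rewrite (morphJ (wreath_perm_morphism a b)) //.
  exact: fixed_wordsJ.
congr (_ *: _); apply: eq_bigr => x Yx; congr (_ *: _).
rewrite prod_cfunE //; apply: eq_bigr => r _.
rewrite cfunE Yx mulr1n.
rewrite [LHS](trace_wreath_repr r.+1 (lam r) (wreath_proj sum_lam r x)).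
by congr (_ * _); apply: eq_bigr => j _; rewrite ffunE.
Qed.

End WreathCharacter.
(** * Sums over products of blocks *)

Lemma prod_sum_fprod (R : comPzSemiRingType) (I : finType) (T_ : I -> finType)
    (F : forall i, T_ i -> R) :
  \prod_i \sum_(x : T_ i) F i x = \sum_(t : fprod T_) \prod_i F i (t i).
Proof.
transitivity (\sum_(t : fprod T_) \prod_(i in I) [ffun x => F i x] (t i)); last first.
  by apply: eq_bigr => t _; apply: eq_bigr => i _; rewrite ffunE.
rewrite (@big_fprod R 0 1 *%R +%R I T_ (fun i => [ffun x => F i x])) /=.
rewrite -(bigA_distr_big_dep (fun i p => p \in tagged_with T_ i)
  (fun i p => untag 0 [ffun x => F i x] p)).
apply: eq_bigr => i _; rewrite -(big_tag (fun i x => [ffun x => F i x] x)).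
by apply: eq_bigr => x _; rewrite ffunE.
Qed.

Section Blocks.

Variables (k b : nat) (alpha : 'I_k -> nat).
Hypothesis sum_alpha : (\sum_(r < k) alpha r)%N = b.

Local Notation elt := (block_elt sum_alpha).
Local Notation blk := (block sum_alpha).

Definition block_pos (i : 'I_b) : 'I_(alpha (blk i)) :=
  tagnat.sig2 (cast_ord (esym sum_alpha) i).

Lemma block_eltE i : exists r (j : 'I_(alpha r)), i = elt j.
Proof. by exists (blk i); apply: block_eltP. Qed.

(** The type of [block_pos] depends on the block, so this inverse law is stated through an arbitrary
    function D of both. *)
Lemma block_pos_elt (X : Type) (D : forall r, 'I_(alpha r) -> X) r j :
  D (blk (elt j)) (block_pos (elt j)) = D r j.
Proof.
rewrite /block_pos /block /block_elt cast_ordK.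
have := tagnat.rankK (Tagged (fun r => 'I_(alpha r)) j).
by move/(congr1 (fun p : {r & 'I_(alpha r)} => D (tag p) (tagged p))).
Qed.

Lemma big_block (R : Type) (idx : R) (op : Monoid.com_law idx) (F : 'I_b -> R) :
  \big[op/idx]_i F i = \big[op/idx]_(r < k) \big[op/idx]_(j < alpha r) F (elt j).
Proof.
rewrite (sig_big_dep (J := fun r => 'I_(alpha r)) xpredT (fun=> xpredT)
  (fun r j => F (@block_elt _ _ _ sum_alpha r j))) /=.
rewrite (reindex (fun p => cast_ord sum_alpha (tagnat.rank p))) /=.
  by apply: eq_bigr => p _; rewrite tagnat.rankE.
apply/onW_bij/bij_comp; last exact: tagnat.rank_bij.
by exists (cast_ord (esym sum_alpha)); [apply: cast_ordK|apply: cast_ordKV].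
Qed.

(** Block-preserving permutations correspond to tuples of permutations of the blocks; then
    distribute. *)
Lemma big_block_perm (R : comPzSemiRingType) (F : forall r, 'S_(alpha r) -> R) :
  \sum_(s : 'S_b | [forall i, blk (s i) == blk i]) \prod_r F r (perm_block sum_alpha r s)
    = \prod_r \sum_(t : 'S_(alpha r)) F r t.
Proof.
rewrite prod_sum_fprod.
pose h (t : fprod (fun r => 'S_(alpha r))) (i : 'I_b) : 'I_b :=
  elt (t (blk i) (block_pos i)).
have hE t r (j : 'I_(alpha r)) : h t (elt j) = elt (t r j).
  exact: (block_pos_elt (fun r j => elt (t r j))).
have h_inj t : injective (h t).
  move=> i1 i2; have [r1 [j1 ->]] := block_eltE i1; have [r2 [j2 ->]] := block_eltE i2.
  rewrite !hE => eq_h.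
  have eq_r := congr1 blk eq_h; rewrite !block_eltK in eq_r.
  by case: r2 / eq_r j2 eq_h => j2 /block_elt_inj/perm_inj ->.
pose H t := perm (h_inj t).
have HB t : [forall i, blk (H t i) == blk i].
  apply/forallP=> i; have [r [j ->]] := block_eltE i.
  by rewrite permE hE !block_eltK.
have HK t r : perm_block sum_alpha r (H t) = t r.
  apply/permP=> j; apply: (@block_elt_inj _ _ _ sum_alpha r).
  rewrite perm_blockP => [|i]; last exact/eqP/(forallP (HB t)).
  by rewrite permE hE.
rewrite (reindex_onto H (fun s => [fprod r => perm_block sum_alpha r s])) /=.
  apply: eq_big => [t|t _]; last by apply: eq_bigr => r _; rewrite HK.
  rewrite HB /=; apply/eqP/fprodP=> r.
  by rewrite fprodE HK.
move=> s /forallP Bs; apply/permP=> i; have [r [j ->]] := block_eltE i.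
by rewrite permE hE fprodE perm_blockP // => l; apply/eqP.
Qed.

Lemma big_block_ffun (R : comPzSemiRingType) (K : finType)
    (F : forall r, {ffun 'I_(alpha r) -> K} -> R) :
  \sum_(f : {ffun 'I_b -> K}) \prod_r F r [ffun j => f (elt j)]
    = \prod_r \sum_(f : {ffun 'I_(alpha r) -> K}) F r f.
Proof.
rewrite prod_sum_fprod.
pose H (t : fprod (fun r => {ffun 'I_(alpha r) -> K})) :=
  [ffun i => t (blk i) (block_pos i)].
have HE t r (j : 'I_(alpha r)) : H t (elt j) = t r j.
  by rewrite ffunE (block_pos_elt (fun r j => t r j)).
rewrite (reindex_onto H (fun f => [fprod r => [ffun j => f (elt j)]])) /=.
  apply: eq_big => [t|t _]; last first.
    by apply: eq_bigr => r _; congr (F r); apply/ffunP=> j; rewrite ffunE HE.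
  by apply/eqP/fprodP=> r; rewrite fprodE; apply/ffunP=> j; rewrite ffunE HE.
move=> f _; apply/ffunP=> i; have [r [j ->]] := block_eltE i.
by rewrite HE fprodE ffunE.
Qed.

End Blocks.
(** * Words fixed by the wreath product, and necklaces *)

Section TupleAction.

Variables (a N : nat).
Implicit Types (u v : a.-tuple 'I_N) (g h : 'S_a).

Definition tuple_act u g : a.-tuple 'I_N := [tuple tnth u (g j) | j < a].

Lemma tuple_act1 u : tuple_act u 1%g = u.
Proof. by apply: eq_from_tnth => j; rewrite tnth_mktuple perm1. Qed.

Lemma tuple_actM u g h : tuple_act (tuple_act u g) h = tuple_act u (h * g)%g.
Proof. by apply: eq_from_tnth => j; rewrite !tnth_mktuple permM. Qed.

Lemma tuple_act_inj g : injective (tuple_act^~ g).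
Proof.
by apply: (can_inj (g := tuple_act^~ g^-1%g)) => u; rewrite tuple_actM mulVg tuple_act1.
Qed.

Lemma cont_sum u : cont u = (\sum_(j < a) U_(tnth u j))%MM.
Proof.
apply/mnmP=> l; rewrite mnmE mnm_sumE -sum1_count big_tuple big_mkcond /=.
by apply: eq_bigr => j _; rewrite mnm1E; case: eqP.
Qed.

Lemma cont_tuple_act u g : cont (tuple_act u g) = cont u.
Proof.
rewrite !cont_sum [RHS](reindex_inj (@perm_inj _ g)) /=.
by apply: eq_bigr => j _; rewrite tnth_mktuple.
Qed.

Variable b : nat.

Lemma fixed_words_wreath (g : {ffun 'I_b -> 'S_a}) (s : 'S_b) :
  fixed_words N (wreath_perm (Wreath g s)) =
    \sum_(W : {ffun 'I_b -> a.-tuple 'I_N} |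
          [forall i, W ((s^-1)%g i) == tuple_act (W i) (g i)])
       \prod_(i < b) 'X_[cont (W i)].
Proof.
pose H (W : {ffun 'I_b -> a.-tuple 'I_N}) : {ffun 'I_(a * b) -> 'I_N} :=
  [ffun k => tnth (W (Defs.interval k)) (offset k)].
have HE W i j : H W (interval_elt i j) = tnth (W i) j.
  by rewrite ffunE interval_eltK1 interval_eltK2.
rewrite /fixed_words (reindex H) /=; last first.
  exists (fun w => [ffun i => [tuple w (interval_elt i j) | j < a]]) => [W _|w _].
    by apply/ffunP=> i; apply: eq_from_tnth => j; rewrite ffunE tnth_mktuple HE.
  apply/ffunP=> k; rewrite -(interval_eltE k) HE ffunE tnth_mktuple.
  by rewrite !interval_eltE.
apply: eq_big => [W|W _].
  apply/eqP/forallP=> [/ffunP fixW i|fixW].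
    apply/eqP/eq_from_tnth => j; have := fixW (interval_elt (s^-1 i)%g j).
    by rewrite ffunE wreath_permE /= permKV !HE tnth_mktuple.
  apply/ffunP=> k; rewrite -(interval_eltE k) ffunE wreath_permE /= !HE.
  set i := Defs.interval k; have := fixW (s i); rewrite permK => /eqP ->.
  by rewrite tnth_mktuple.
rewrite prod_mpolyX; congr 'X_[_].
under [RHS]eq_bigr do rewrite cont_sum.
rewrite pair_big /= /word_content.
rewrite (reindex (fun p : 'I_b * 'I_a => interval_elt p.1 p.2)) /=; last first.
  exists (fun k => (Defs.interval k, offset k)) => [[i j] _|k _] /=.
    by rewrite interval_eltK1 interval_eltK2.
  exact: interval_eltE.
by apply: eq_bigr => -[i j] _; rewrite HE.
Qed.

End TupleAction.

Lemma nth_word_pow (T : Type) (d : T) k (v : seq T) j :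
  (j < k * size v)%N -> nth d (word_pow k v) j = nth d v (j %% size v).
Proof.
elim: k j => // k IHk j; rewrite mulSn => lt_j.
rewrite /word_pow /= nth_cat; case: ltnP => [lt_jv|le_vj]; first by rewrite modn_small.
rewrite IHk; last by rewrite ltn_subLR.
by rewrite -[in RHS](subnK le_vj) modnDr.
Qed.

Lemma size_word_pow (T : Type) k (v : seq T) : size (word_pow k v) = (k * size v)%N.
Proof. by elim: k => //= k IHk; rewrite size_cat -/(word_pow k v) IHk mulSn. Qed.

Lemma word_powA (T : Type) q k (u : seq T) : word_pow q (word_pow k u) = word_pow (q * k) u.
Proof.
elim: q => // q IHq; rewrite mulSn /word_pow nseqD flatten_cat /= -/(word_pow k u).
by congr (_ ++ _).
Qed.

(** * Periods and frequency of a word *)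

Section Periods.

Variables (a N : nat) (w : a.-tuple 'I_N).
Hypothesis a_gt0 : (0 < a)%N.

Local Notation rho := (rotation a).

Definition period k := tuple_act w (rho ^+ k)%g == w.

Lemma periodP k : reflect (forall j, nth (tnth w (Ordinal a_gt0)) w ((j + k) %% a)
    = nth (tnth w (Ordinal a_gt0)) w (j %% a)) (period k).
Proof.
set d := tnth w _; have tE (i : 'I_a) : tnth w i = nth d w i by apply: tnth_nth.
apply: (iffP eqP) => [eq_w j|eq_w].
  have lt_j : (j %% a < a)%N by rewrite ltn_mod.
  have /(congr1 (fun v => tnth v (Ordinal lt_j))) := eq_w.
  by rewrite tnth_mktuple !tE rotationX /= modnDml.
apply: eq_from_tnth => j; rewrite tnth_mktuple !tE rotationX eq_w modn_small //.
Qed.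

Lemma rotation_order : (rho ^+ a = 1)%g.
Proof.
apply/permP=> i; apply: val_inj.
by rewrite /= rotationX perm1 modnDr modn_small.
Qed.

Lemma periodD k l : period k -> period (k + l) = period l.
Proof. by move=> /eqP pk; rewrite /period addnC expgD -tuple_actM pk. Qed.

Lemma period_min : exists2 p, (0 < p)%N & forall k, period k = (p %| k)%N.
Proof.
have ex_p : exists p, (0 < p)%N && period p.
  by exists a; rewrite a_gt0 /period rotation_order tuple_act1 eqxx.
case: (ex_minnP ex_p) => p /andP[p_gt0 pp] min_p; exists p => // k.
have pm q : period (q * p).
  elim: q => [|q IHq]; first by rewrite /period expg0 tuple_act1.
  by rewrite mulSn periodD.
rewrite {1}(divn_eq k p) periodD //; apply/idP/idP=> [pk|/eqP->]; last exact: (pm 0).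
rewrite /dvdn; case: posnP => // k_gt0.
by have := min_p (k %% p)%N; rewrite k_gt0 pk leqNgt ltn_mod p_gt0 => /(_ isT).
Qed.

Lemma word_pow_period k (v : seq 'I_N) : w = word_pow k v :> seq _ -> period (size v).
Proof.
move=> def_w; have sz : (k * size v)%N = a.
  by rewrite -size_word_pow -def_w size_tuple.
have dv : (size v %| a)%N by rewrite -sz dvdn_mull.
apply/periodP=> j; rewrite def_w !nth_word_pow ?sz ?ltn_mod //.
by rewrite !modn_dvdm // modnDr.
Qed.

Lemma period_word_pow p c d : period p -> (0 < p)%N -> a = ((c + d) * p)%N ->
  take (c * p) w = word_pow c (take p w) :> seq _.
Proof.
move=> pp p_gt0 def_a; pose x0 := tnth w (Ordinal a_gt0).
have sz_w : size w = a := size_tuple w.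
have le_ca : (c * p <= a)%N by rewrite def_a mulnDl leq_addr.
have [->|c_gt0] := posnP c; first by rewrite take0.
have le_pa : (p <= a)%N by apply: leq_trans le_ca; rewrite leq_pmull.
have sz_p : size (take p w) = p by rewrite size_takel ?sz_w.
apply: (@eq_from_nth _ x0); first by rewrite size_word_pow sz_p size_takel ?sz_w.
rewrite size_takel ?sz_w // => j lt_j; rewrite nth_take // nth_word_pow sz_p //.
rewrite nth_take ?ltn_mod //.
have lt_ja := leq_trans lt_j le_ca.
have pq q : period (q * p).
  elim: q => [|q IHq]; first by rewrite /period expg0 tuple_act1.
  by rewrite mulSn periodD.
have /periodP/(_ (j %% p)%N) := pq (j %/ p)%N.
rewrite addnC -divn_eq (modn_small lt_ja) => ->; rewrite modn_small //.
by apply: leq_ltn_trans lt_ja; apply: leq_mod.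
Qed.

(** With p the least period, a / p passes the test in [freq], so the search succeeds. Whatever f it
    finds, a / f is a period, hence a multiple of p, and primitivity of the prefix of that length
    gives a / f = p. *)
Lemma freqP : (0 < freq w)%N /\ (freq w %| a)%N /\
  forall k, period k = (a %/ freq w %| k)%N.
Proof.
have [p p_gt0 pP] := period_min.
have sz_w : size w = a := size_tuple w.
have p_a : (p %| a)%N by rewrite -pP /period rotation_order tuple_act1.
have pp : period p by rewrite pP.
have pow_p q : (p %| q)%N -> (q <= a)%N -> take q w = word_pow (q %/ p) (take p w) :> seq _.
  move=> /dvdnP[c ->] le_ca; rewrite mulnK //.
  apply: (@period_word_pow _ _ (a %/ p - c)) => //.
  by rewrite subnKC ?divnK // leq_divRL.
have w_pow : w = word_pow (a %/ p) (take p w) :> seq _.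
  by rewrite -pow_p // take_oversize // sz_w.
pose P f := let v := take (size w %/ f) w in primitive_word v && (w == word_pow f v :> seq _).
have le_pa : (p <= a)%N by apply: dvdn_leq.
have P_p : P (a %/ p)%N.
  have ap : (a %/ (a %/ p) = p)%N.
    by apply/eqP; rewrite eq_sym eqn_div ?dvdn_div // ?divn_gt0 // mulnC divnK.
  rewrite /P /= sz_w ap -w_pow eqxx andbT.
  apply/primitive_wordP; split=> [/(congr1 size)|k u def_v].
    by rewrite size_takel ?sz_w //= => p0; rewrite p0 in p_gt0.
  have := congr1 size def_v; rewrite size_takel ?sz_w // size_word_pow => sz_u.
  have u_gt0 : (0 < size u)%N by move: p_gt0; rewrite sz_u muln_gt0 => /andP[].
  have : period (size u).
    by apply: (@word_pow_period (a %/ p * k)); rewrite -word_powA -def_v.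
  rewrite pP sz_u => /dvdn_leq -/(_ u_gt0); rewrite -{2}[size u]mul1n leq_pmul2r //.
  by case: k {def_v} sz_u => [|[|k]] // sz_u; rewrite sz_u in p_gt0.
have hasP : has P (iota 0 (size w).+1).
  apply/hasP; exists (a %/ p)%N => //; rewrite mem_iota sz_w add0n ltnS.
  exact: leq_div.
have := nth_find 0%N hasP; have := hasP; rewrite has_find size_iota => lt_f.
rewrite nth_iota // add0n -/(freq w) /P sz_w => /= /andP[/primitive_wordP[_ prim] /eqP def_w].
have := congr1 size def_w; rewrite sz_w size_word_pow => sz_f.
have f_gt0 : (0 < freq w)%N by move: a_gt0; rewrite {1}sz_f muln_gt0 => /andP[].
have f_a : (freq w %| a)%N by rewrite {2}sz_f dvdn_mulr.
split=> //; split=> // k; rewrite pP; congr (_ %| _)%N.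
have sz_v : size (take (a %/ freq w) w) = (a %/ freq w)%N.
  by rewrite size_takel // sz_w leq_div.
have := word_pow_period def_w; rewrite sz_v pP => p_f.
have := prim _ _ (pow_p _ p_f (leq_div _ _)).
by move/eqP; rewrite eq_sym eqn_div // mul1n => /eqP.
Qed.

End Periods.

(** * Necklaces as orbits of the cyclic group *)

Section Necklaces.

Variables (a N : nat).
Hypothesis a_gt0 : (0 < a)%N.
Implicit Types (u v w : a.-tuple 'I_N) (g h : 'S_a) (r : nat).

Local Notation rho := (rotation a).
Local Notation Ca := (Cyc a).

Lemma card_Cyc : #|Ca| = a.
Proof.
apply/eqP; rewrite -orderE eqn_dvd order_dvdn rotation_order eqxx /=.
have /permP/(_ (Ordinal a_gt0))/(congr1 val) := expg_order rho.
by rewrite /= rotationX perm1 /= add0n => /eqP.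
Qed.

Definition tuple_stab v : {set 'S_a} := [set g in Ca | tuple_act v g == v].

Lemma rot_tuple_act (i : 'I_a) v : [tuple of rot i v] = tuple_act v (rho ^+ i)%g.
Proof.
have x0 : 'I_N := tnth v i.
apply: eq_from_tnth => j; rewrite tnth_mktuple !(tnth_nth x0) /= rotationX.
rewrite /rot nth_cat size_drop size_tuple nth_drop.
case: ltnP => [lt_j|le_j]; first by rewrite modn_small addnC // -ltn_subRL.
have lt_i := ltn_ord i; have lt_ja := ltn_ord j.
rewrite nth_take; last by rewrite ltn_subLR // subnK // ltnW.
congr (nth _ v _).
have -> : (j + i = (j - (a - i)) + a)%N by rewrite leq_subLR in le_j; lia.
by rewrite modnDr modn_small //; lia.
Qed.

Lemma mem_necklace u v :
  reflect (exists2 g, g \in Ca & u = tuple_act v g) (u \in necklace_of v).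
Proof.
apply: (iffP imsetP) => [[i _ ->]|[g /cyclePmin[k lt_k ->] ->]].
  by exists (rho ^+ i)%g; rewrite ?mem_cycle ?rot_tuple_act.
have {}lt_k : (k < a)%N by rewrite -card_Cyc -orderE.
by exists (Ordinal lt_k); rewrite ?rot_tuple_act.
Qed.

Lemma necklace_refl v : v \in necklace_of v.
Proof. by apply/mem_necklace; exists 1%g; rewrite ?group1 ?tuple_act1. Qed.

Lemma necklace_act v g : g \in Ca -> necklace_of (tuple_act v g) = necklace_of v.
Proof.
move=> Cg; apply/setP=> u; apply/mem_necklace/mem_necklace=> -[h Ch ->].
  by exists (h * g)%g; rewrite ?groupM ?tuple_actM.
by exists (h * g^-1)%g; rewrite ?groupM ?groupV // tuple_actM mulgKV.
Qed.

Lemma eq_necklace u v : (necklace_of u == necklace_of v) = (u \in necklace_of v).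
Proof.
apply/eqP/idP=> [<-|/mem_necklace[g Cg ->]]; first exact: necklace_refl.
exact: necklace_act.
Qed.

Lemma tuple_stab_act v g : g \in Ca -> tuple_stab (tuple_act v g) = tuple_stab v.
Proof.
move=> Cg; apply/setP=> h; rewrite !inE; case Ch: (h \in Ca) => //=.
rewrite tuple_actM (centsP (cycle_abelian rho) h Ch g Cg) -tuple_actM.
by rewrite (inj_eq (@tuple_act_inj _ _ g)).
Qed.

Lemma freq_act v g : g \in Ca -> freq (tuple_act v g) = freq v.
Proof.
move=> Cg; have [f_gt0 [f_a perP]] := freqP v a_gt0.
have [f'_gt0 [f'_a perP']] := freqP (tuple_act v g) a_gt0.
have eq_per k : period (tuple_act v g) k = period v k.
  have := congr1 (fun A : {set 'S_a} => (rho ^+ k)%g \in A) (tuple_stab_act v Cg).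
  by rewrite !inE mem_cycle.
have : (a %/ freq (tuple_act v g) = a %/ freq v)%N.
  by apply/eqP; rewrite eqn_dvd -perP -perP' eq_per perP dvdnn -eq_per perP' dvdnn.
by move/(congr1 (fun q => a %/ q)%N); rewrite !divnA ?dvdnn // !mulKn.
Qed.

(** The default u is for empty C only: on necklaces the choice does not depend on u. *)
Definition necklace_rep (C : {set a.-tuple 'I_N}) u := odflt u [pick v in C].

Definition necklace_shift u : 'S_a :=
  odflt 1%g [pick g in Ca | u == tuple_act (necklace_rep (necklace_of u) u) g].

Lemma necklace_shiftP u : necklace_shift u \in Ca /\
  u = tuple_act (necklace_rep (necklace_of u) u) (necklace_shift u).
Proof.
rewrite /necklace_shift; case: pickP => [g /andP[Cg /eqP eq_u] //|no_g].
have : u \in necklace_of (necklace_rep (necklace_of u) u).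
  rewrite -eq_necklace eq_sym eq_necklace /necklace_rep.
  by case: pickP => //= _; apply: necklace_refl.
by case/mem_necklace=> g Cg eq_u; have := no_g g; rewrite /= Cg {1}eq_u eqxx.
Qed.

(** Orbit-stabiliser by double counting: every rotation sends v to exactly one word. *)
Lemma sum_card_stab v :
  (\sum_(u | necklace_of u == necklace_of v) #|tuple_stab u|)%N = a.
Proof.
transitivity (\sum_u \sum_(g in Ca) (u == tuple_act v g))%N.
  rewrite big_mkcond /=; apply: eq_bigr => u _; case: eqP => [/eqP|ne_C]; last first.
    rewrite big1 // => g Cg; case: eqP => // eq_u.
    by rewrite eq_u necklace_act in ne_C.
  rewrite eq_necklace => /mem_necklace[g0 Cg0 ->].
  rewrite tuple_stab_act // (reindex_inj (mulgI g0)) -sum1_card big_mkcond.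
  rewrite [RHS]big_mkcond; apply: eq_bigr => g _.
  rewrite groupMl // inE -tuple_actM eq_sym (inj_eq (@tuple_act_inj _ _ g0)).
  by case: (g \in Ca); case: eqP.
rewrite exchange_big /= (eq_bigr (fun=> 1%N)) ?sum1_card ?card_Cyc // => g _.
by rewrite (bigD1 (tuple_act v g)) //= eqxx big1 // => u /negbTE->.
Qed.

Lemma mem_NFD r u : (necklace_of u \in NFD a r N) = (freq u %| r)%N.
Proof.
apply/imsetP/idP=> [[v + /eqP]|f_r]; last by exists u; rewrite ?inE.
by rewrite inE eq_necklace => f_r /mem_necklace[g Cg ->]; rewrite freq_act.
Qed.

Lemma necklace_contE u : necklace_cont (necklace_of u) = cont u.
Proof.
rewrite /necklace_cont; case: pickP => [v|/(_ u)]; last by rewrite necklace_refl.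
by case/mem_necklace=> g _ ->; rewrite cont_tuple_act.
Qed.

End Necklaces.

(** * Character sums over rotations *)

Section RotationSums.

Variables (a N : nat) (omega : algC).
Hypotheses (prim_omega : a.-primitive_root omega) (a_gt0 : (0 < a)%N).
Implicit Types (u v w : a.-tuple 'I_N) (g h : 'S_a) (r : nat).

Local Notation rho := (rotation a).
Local Notation Ca := (Cyc a).

Definition chi r g : algC := omega ^+ (r * rotation_log g).

Lemma chi_rotation r k : chi r (rho ^+ k)%g = omega ^+ (r * k).
Proof.
rewrite /chi (rotation_logX (Ordinal a_gt0)); apply/eqP.
by rewrite (eq_prim_root_expr prim_omega) modnMmr.
Qed.

Lemma chiM r : {in Ca &, {morph chi r : g h / (g * h)%g >-> g * h}}.
Proof.
by move=> _ _ /cycleP[i ->] /cycleP[j ->]; rewrite -expgD !chi_rotation mulnDr exprD.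
Qed.

Lemma chi_neq0 r g : chi r g != 0.
Proof. by rewrite expf_neq0 // (prim_root_eq0 prim_omega) -lt0n. Qed.

(** With f the frequency, the rotations fixing v are the powers of g0 = rho^(a/f), whose character
    value omega^(r a/f) is 1 iff f divides r. Otherwise translation by g0 multiplies the sum by a
    scalar other than 1. *)
Lemma sum_chi_stab r v :
  \sum_(g in tuple_stab v) chi r g = #|tuple_stab v|%:R * (freq v %| r)%:R.
Proof.
have [f_gt0 [f_a perP]] := freqP v a_gt0; set f := freq v in f_gt0 f_a perP *.
have stabP k : ((rho ^+ k)%g \in tuple_stab v) = (a %/ f %| k)%N.
  by rewrite inE mem_cycle -perP.
have [f_r|nf_r] := boolP (f %| r)%N.
  rewrite (eq_bigr (fun=> 1)) ?sumr_const ?mulr1 // => g Sg.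
  have /cycleP[k def_g] : g \in Ca by move: Sg; rewrite inE => /andP[].
  rewrite def_g stabP in Sg; rewrite def_g chi_rotation; apply/eqP.
  rewrite -(prim_order_dvd prim_omega) -{1}(divnK f_a) mulnC.
  exact: dvdn_mul.
rewrite mulr0; pose g0 := (rho ^+ (a %/ f))%g.
have Sg0 : g0 \in tuple_stab v by rewrite stabP.
have nt_g0 : chi r g0 != 1.
  rewrite chi_rotation -(prim_order_dvd prim_omega) -{1}(divnK f_a) mulnC.
  by rewrite dvdn_pmul2r // divn_gt0 // dvdn_leq.
have Cg0 : g0 \in Ca by apply: mem_cycle.
set S := \sum_(g in _) _; have : S = chi r g0 * S.
  rewrite {1}/S (reindex_inj (mulgI g0)) mulr_sumr /=.
  apply: eq_big => [g|g /[!inE]/andP[]].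
    rewrite !inE groupMl // -tuple_actM; congr (_ && _).
    apply/eqP/eqP=> [gv|->]; last by move: Sg0; rewrite inE => /andP[_ /eqP].
    apply: (@tuple_act_inj _ _ g0); rewrite gv.
    by move: Sg0; rewrite inE => /andP[_ /eqP->].
  by rewrite groupMl // => Cg _; rewrite chiM.
move/eqP; rewrite -subr_eq0 -{1}[S]mul1r -mulrBl mulf_eq0 subr_eq0 eq_sym (negbTE nt_g0).
by move/eqP.
Qed.

Definition rotation_sum r u v : algC :=
  \sum_(g in Ca) chi r g * (u == tuple_act v g)%:R.

(* The first factor is a coboundary: it telescopes in the product over all    *)
(* positions i, with u the word at s^-1 i and v the word at i.                *)
Lemma rotation_sumE r u v : rotation_sum r u v =
  (chi r (necklace_shift u) / chi r (necklace_shift v))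
  * (#|tuple_stab v|%:R * ((necklace_of u == necklace_of v) && (freq v %| r)%N)%:R).
Proof.
case: eqP => [eq_C|ne_C]; last first.
  rewrite /= !mulr0 /rotation_sum big1 // => g Cg.
  case: eqP => [eq_u|_]; last by rewrite mulr0.
  by rewrite eq_u necklace_act in ne_C.
rewrite /= -sum_chi_stab mulr_sumr.
have [Cu eq_u] := necklace_shiftP a_gt0 u; have [Cv eq_v] := necklace_shiftP a_gt0 v.
set x := necklace_rep _ u in eq_u; set y := necklace_rep _ v in eq_v.
have eq_xy : x = y.
  rewrite /x /y eq_C /necklace_rep; case: pickP => //= /(_ v).
  by rewrite necklace_refl.
(* g0 carries v to u, so the rotations that do so form the translate of the stabiliser of v by
   g0. *)
pose g0 := (necklace_shift u * (necklace_shift v)^-1)%g.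
have Cg0 : g0 \in Ca by rewrite groupM ?groupV.
have vg0 : tuple_act v g0 = u.
  by rewrite eq_v tuple_actM mulgKV -eq_xy -eq_u.
rewrite /rotation_sum (reindex_inj (mulgI g0)) /= [RHS]big_mkcond [LHS]big_mkcond /=.
apply: eq_bigr => g _; rewrite groupMl // inE.
case: ifP => Cg //=; rewrite chiM // chiM ?groupV // -tuple_actM -vg0 eq_sym.
rewrite (inj_eq (@tuple_act_inj _ _ g0)).
have -> : chi r (necklace_shift v)^-1%g = (chi r (necklace_shift v))^-1.
  apply: (mulIf (chi_neq0 r (necklace_shift v))).
  rewrite -chiM ?groupV // mulVg mulVf ?chi_neq0 // -(expg0 rho) chi_rotation.
  by rewrite muln0.
by case: ifP; rewrite ?mulr1 ?mulr0.
Qed.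

End RotationSums.

(** * Summing out the base group and splitting into blocks *)

Section Assembly.

Variables (a b N : nat) (omega : algC).
Hypotheses (prim_omega : a.-primitive_root omega) (a_gt0 : (0 < a)%N).
Variable lam : 'I_a -> seq nat.
Hypothesis sum_lam : (\sum_(r < a) sumn (lam r))%N = b.

Local Notation blk := (block sum_lam).
Local Notation elt := (block_elt sum_lam).
Local Notation pblk := (perm_block sum_lam).
Local Notation necklace := {set a.-tuple 'I_N}.
Local Notation block_perm s := [forall i, blk (s i) == blk i].
Local Notation multi_chi s :=
  (\prod_(r < a) Specht_char (sumn (lam r)) (lam r) (pblk r s)).

Lemma sum_wrY (V : nmodType) (F : wreath 'S_a b -> V) :
  \sum_(x in wrY (Cyc a) sum_lam) F x =
    \sum_(s : 'S_b | block_perm s)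
      \sum_(g : {ffun 'I_b -> 'S_a} | g \in ffun_on (mem (Cyc a))) F (Wreath g s).
Proof.
rewrite pair_big_dep (reindex (fun p : 'S_b * {ffun 'I_b -> 'S_a} => Wreath p.2 p.1)) /=.
  apply: eq_bigl => -[s g] /=; rewrite !inE andbC; congr (_ && _).
by exists (fun x => (wperm x, wbase x)) => [[]|[]].
Qed.

Lemma card_wrY : #|wrY (Cyc a) sum_lam|%:R
  = a%:R ^+ b * \prod_(r < a) #|[set: 'S_(sumn (lam r))]|%:R :> algC.
Proof.
rewrite -sum1_card natr_sum sum_wrY.
under eq_bigr => s _.
  rewrite -natr_sum sum1_card card_ffun_on card_Cyc // card_ord natrX -[_ ^+ _]mulr1.
  over.
rewrite -mulr_sumr; congr (_ * _).
transitivity (\sum_(s : 'S_b | block_perm s) \prod_(r < a) 1 : algC).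
  by apply: eq_bigr => s _; rewrite big1.
rewrite (big_block_perm sum_lam (fun r _ => 1)); apply: eq_bigr => r _.
by rewrite sumr_const cardsT.
Qed.

Definition fixed_necklaces (s : 'S_b) : {mpoly algC[N]} :=
  \sum_(f : {ffun 'I_b -> necklace} |
       [forall i, (f i \in NFD a (blk i).+1 N) && (f (s i) == f i)])
    \prod_(i < b) 'X_[necklace_cont (f i)].

(** As s preserves blocks, the exponent at i equals that at s^-1 i, so reindexing by s makes the
    coboundary factors cancel. *)
Lemma prod_rotation_sum (s : 'S_b) (W : {ffun 'I_b -> a.-tuple 'I_N}) :
    (forall i, blk (s i) = blk i) ->
  \prod_(i < b) rotation_sum omega (blk i).+1 (W (s^-1 i)%g) (W i)
    = \prod_(i < b) (#|tuple_stab (W i)|%:R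
       * ((necklace_of (W (s^-1 i)%g) == necklace_of (W i))
           && (freq (W i) %| (blk i).+1)%N)%:R).
Proof.
move=> Bs; under eq_bigr do rewrite rotation_sumE //.
rewrite big_split /= prodf_div (reindex_inj (@perm_inj _ s)) /=.
under eq_bigr do rewrite permK Bs.
by rewrite divff ?mul1r //; apply/prodf_neq0 => i _; apply: chi_neq0.
Qed.

Lemma sum_prod_stab (f : {ffun 'I_b -> necklace}) :
    (forall i, exists u, f i = necklace_of u) ->
  \sum_(W : {ffun 'I_b -> a.-tuple 'I_N} | [ffun i => necklace_of (W i)] == f)
     \prod_(i < b) #|tuple_stab (W i)|%:R = a%:R ^+ b :> algC.
Proof.
move=> f_im.
rewrite (eq_bigl (mem (family (fun i => [pred u | necklace_of u == f i])))); last first.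
  move=> W; apply/eqP/familyP => [<- i|fW]; first by rewrite inE ffunE.
  by apply/ffunP=> i; rewrite ffunE; apply/eqP/fW.
rewrite -(bigA_distr_big_dep _ (fun i u => #|tuple_stab u|%:R)) /=.
rewrite (eq_bigr (fun=> a%:R)) ?prodr_const ?card_ord // => i _.
have [u ->] := f_im i; rewrite -natr_sum; congr _%:R.
exact: sum_card_stab.
Qed.

(** Group the tuples of words by their tuples of necklaces f. The monomial and the condition depend
    on f alone, and the stabiliser orders add up to a^b. *)
Lemma sum_necklaces (s : 'S_b) : (forall i, blk (s i) = blk i) ->
  \sum_(W : {ffun 'I_b -> a.-tuple 'I_N})
     (\prod_(i < b) rotation_sum omega (blk i).+1 (W (s^-1 i)%g) (W i))
       *: (\prod_(i < b) 'X_[cont (W i)] : {mpoly algC[N]})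
  = a%:R ^+ b *: fixed_necklaces s.
Proof.
move=> Bs; under eq_bigr do rewrite prod_rotation_sum //.
rewrite (partition_big (fun W => [ffun i => necklace_of ((W : {ffun 'I_b -> a.-tuple 'I_N}) i)])
  xpredT) //= scaler_sumr [RHS]big_mkcond; apply: eq_bigr => f _ /=.
have in_f W i : [ffun i => necklace_of (W i)] == f -> necklace_of (W i) = f i.
  by move=> /eqP<-; rewrite ffunE.
case: ifP => [/forallP cond_f|ncond_f]; last first.
  rewrite big1 // => W /in_f eq_W.
  move: ncond_f => /negbT; rewrite negb_forall => /existsP[i].
  rewrite negb_and => ni.
  suffices [j nj] : exists j, ~~ ((necklace_of (W (s^-1 j)%g) == necklace_of (W j))
           && (freq (W j) %| (blk j).+1)%N).
    by rewrite (bigD1 j) //= (negbTE nj) mulr0 mul0r scale0r.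
  case/orP: ni => [nNFD|nfix].
    by exists i; rewrite negb_and -(mem_NFD a_gt0) !eq_W nNFD orbT.
  (* The factor at position s i compares the necklaces at i and s i. *)
  by exists (s i); rewrite permK !eq_W negb_and eq_sym nfix.
rewrite -(sum_prod_stab (f := f)) => [|i]; last first.
  by have /andP[/imsetP[u _ ->] _] := cond_f i; exists u.
rewrite scaler_suml; apply: eq_bigr => W /in_f eq_W; congr (_ *: _).
  apply: eq_bigr => i _; rewrite -(mem_NFD a_gt0) !eq_W.
  have /andP[-> _] := cond_f i; have /andP[_] := cond_f (s^-1 i)%g.
  by rewrite permKV eq_sym => ->; rewrite mulr1.
by apply: eq_bigr => i _; rewrite -necklace_contE // eq_W.
Qed.

(** The fixed-word condition is a conjunction over positions, each involving one g i, so the sum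
    over all g distributes into a product of [rotation_sum]. *)
Lemma sum_rotations (s : 'S_b) : (forall i, blk (s i) = blk i) ->
  \sum_(g : {ffun 'I_b -> 'S_a} | g \in ffun_on (mem (Cyc a)))
     block_character omega sum_lam (Wreath g s) *: fixed_words N (wreath_perm (Wreath g s))
  = a%:R ^+ b *: (multi_chi s *: fixed_necklaces s).
Proof.
move=> Bs; rewrite scalerA mulrC -scalerA -sum_necklaces // scaler_sumr.
transitivity (\sum_(g : {ffun 'I_b -> 'S_a} | g \in ffun_on (mem (Cyc a)))
   \sum_(W : {ffun 'I_b -> a.-tuple 'I_N})
     (multi_chi s * \prod_(i < b) (chi omega (blk i).+1 (g i)
         * (W (s^-1 i)%g == tuple_act (W i) (g i))%:R))
      *: (\prod_(i < b) 'X_[cont (W i)] : {mpoly algC[N]})).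
  apply: eq_bigr => g _; rewrite fixed_words_wreath scaler_sumr big_mkcond /=.
  apply: eq_bigr => W _; case: ifP => [/forallP cond|/negbT].
    congr (_ *: _); rewrite /block_character big_split mulrC /=; congr (_ * _).
    rewrite (big_block sum_lam); apply: eq_bigr => r _; apply: eq_bigr => j _ /=.
    by rewrite (eqP (cond _)) eqxx mulr1 block_eltK.
  rewrite negb_forall => /existsP[i /negbTE ni].
  by rewrite (bigD1 i) //= ni mulr0 mul0r mulr0 scale0r.
rewrite exchange_big; apply: eq_bigr => W _ /=.
rewrite -scaler_suml -mulr_sumr scalerA; congr (_ * _ *: _).
by rewrite -(bigA_distr_big _ (fun i g => chi omega (blk i).+1 g
         * (W (s^-1 i)%g == tuple_act (W i) g)%:R)).
Qed.

Definition block_necklaces (r : 'I_a) (k : 'S_(sumn (lam r))) : {mpoly algC[N]} :=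
  \sum_(f : {ffun 'I_(sumn (lam r)) -> necklace} |
       [forall i, (f i \in NFD a r.+1 N) && (f (k i) == f i)])
    \prod_i 'X_[necklace_cont (f i)].

Lemma fixed_necklaces_prod (s : 'S_b) : (forall i, blk (s i) = blk i) ->
  multi_chi s *: fixed_necklaces s
    = \prod_(r < a) (Specht_char (sumn (lam r)) (lam r) (pblk r s) *: block_necklaces (pblk r s)).
Proof.
move=> Bs; rewrite scaler_prod; congr (_ *: _).
rewrite /block_necklaces; under [RHS]eq_bigr do rewrite big_mkcond.
rewrite -(big_block_ffun sum_lam (fun r f =>
   if [forall i, (f i \in NFD a r.+1 N) && (f (pblk r s i) == f i)]
   then \prod_i 'X_[necklace_cont (f i)] else 0)).
rewrite /fixed_necklaces big_mkcond; apply: eq_bigr => f _ /=.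
case: ifP => [/forallP cond|/negbT].
  rewrite (big_block sum_lam); apply: eq_bigr => r _; rewrite ifT.
    by apply: eq_bigr => j _; rewrite ffunE.
  apply/forallP=> j; rewrite !ffunE perm_blockP //.
  by have := cond (elt j); rewrite block_eltK.
rewrite negb_forall => /existsP[i ni]; have [r [j eq_i]] := block_eltE sum_lam i.
rewrite (bigD1 r) //= ifF ?mul0r //; apply/negbTE; rewrite negb_forall.
by apply/existsP; exists j; move: ni; rewrite !ffunE perm_blockP // eq_i block_eltK.
Qed.

End Assembly.
Theorem theorem1p8 (a b : nat) (a_gt0 : (0 < a)%N) (b_gt0 : (0 < b)%N)
    (omega : algC) (prim_omega : a.-primitive_root omega)
    (lam : 'I_a -> seq nat)
    (lam_part : forall r : 'I_a, is_partition (lam r))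
    (sum_lam : (\sum_(r < a) sumn (lam r))%N = b)
    (N : nat) :
  Ch ('Ind[[set: 'S_(a * b)], wreath_image a b]
        (cfIsom (wreath_perm_isom b a_gt0)
                (Specht_wreath prim_omega sum_lam))) N
  = \prod_(r < a) plethysm (schur (lam r)) (NFD_cont a r.+1 N).
Proof.
have card_neq0 n : #|[set: 'S_n]|%:R != 0 :> algC by rewrite pnatr_eq0 -lt0n cardG_gt0.
have a_neq0 : a%:R ^+ b != 0 :> algC by rewrite expf_neq0 // pnatr_eq0 -lt0n.
rewrite Ch_Ind_Specht_wreath card_wrY // sum_wrY.
rewrite (eq_bigr (fun s => a%:R ^+ b *: \prod_(r < a)
  (Specht_char (sumn (lam r)) (lam r) (perm_block sum_lam r s)
     *: block_necklaces N (perm_block sum_lam r s)))) => [|s /forallP Bs]; last first.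
  have {}Bs i : block sum_lam (s i) = block sum_lam i by apply/eqP.
  by rewrite (sum_rotations _ prim_omega) // fixed_necklaces_prod.
(* The factor a^b of [card_wrY] cancels; the orders of the symmetric groups remain and normalise the
   averages of the separate plethysms. *)
rewrite -scaler_sumr scalerA invfM mulrAC mulVf // mul1r.
rewrite (big_block_perm sum_lam (fun r k =>
  Specht_char (sumn (lam r)) (lam r) k *: block_necklaces N k)).
rewrite -prodfV -scaler_prod; apply: eq_bigr => r _.
by rewrite /NFD_cont (plethysm_schur_enum (lam_part r) erefl).
Qed.
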